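(* Let $P=\{p_1,p_2,\ldots,p_n\}$ be an input set of $n$ colored points in an axis-aligned rectangle $R$, sorted from top to bottom. Then a crossing-free backbone labeling of $P$ with the minimum number of infinite backbones (equivalently, the minimum number of labels) can be computed in $O(n)$ time.
   Context: Setting: $P$ is a finite set of points in an axis-aligned rectangle $R$; each $p\in P$ has a color $c(p)$ from a finite color set $C$; no two points share the same $x$- or the same $y$-coordinate. Points are indexed in decreasing order of $y$-coordinate ($p_1$ topmost). A backbone labeling of $P$ consists of a finite set $\mathcal L$ of colored labels on the boundary (left or right side) of $R$, together with an assignment of each point $p\in P$ to a label in $\mathcal L$ of color $c(p)$. A label $l$ is described by its color $c(l)$, the $y$-coordinate $y(l)$ of its backbone, and the set $P(l)$ of points assigned to it. The backbone leader of $l$ consists of a horizontal segment at height $y(l)$ (the backbone) together with, for each $p\in P(l)$, the vertical segment joining $p$ to the backbone. An infinite backbone spans the whole width of $R$. Leaders of distinct labels may not overlap. The labeling is crossing-free if leaders of distinct labels do not cross, i.e. are disjoint. Several labels may have the same color, and here there is no upper bound on the number of labels. *)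

(* Defs.v *)
From HB Require Import structures.
From mathcomp Require Import all_boot all_order all_algebra.
From mathcomp Require Import classical_sets reals.

Set Implicit Arguments.
Unset Strict Implicit.
Unset Printing Implicit Defensive.

Import Order.TTheory GRing.Theory Num.Theory.

Local Open Scope classical_set_scope.
Local Open Scope ring_scope.

(** * Backbone labelings with infinite backbones *)

Record rectangle (R : realType) := Rectangle {
  xleft : R; xright : R; ybottom : R; ytop : R }.

Definition nondegenerate (R : realType) (B : rectangle R) : Prop :=
  xleft B < xright B /\ ybottom B < ytop B.

Record colored_point (R : realType) (C : finType) := ColoredPoint {
  px : R; py : R; pcolor : C }.

Definition in_rectangle (R : realType) (C : finType) (B : rectangle R)
    (p : colored_point R C) : Prop :=
  xleft B <= px p <= xright B /\ ybottom B <= py p <= ytop B.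

(* The strict inequality of [sorted] also says that the y-coordinates are
   pairwise distinct; [tnth P 0] is the topmost point. *)
Definition valid_input (R : realType) (C : finType) (n : nat)
    (B : rectangle R) (P : n.-tuple (colored_point R C)) : Prop :=
  [/\ nondegenerate B,
      forall i, in_rectangle B (tnth P i),
      uniq [seq px p | p <- P] &
      sorted (fun p q => py q < py p) P].

(* [lright l] tells on which of the two vertical sides of the rectangle the
   label lies.  An infinite backbone joins both sides, so the leader below does
   not depend on it. *)
Record label (R : realType) (C : finType) := Label {
  lright : bool; lheight : R; lcolor : C }.

(* [lassign i] is the label of the i-th point, so P(l) is the fibre of
   [lassign] over l; a color may be carried by several labels, and a label may
   have no point. *)
Record labeling (R : realType) (C : finType) (n : nat) := Labeling {
  nlabels : nat;
  llabel : 'I_nlabels -> label R C;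
  lassign : 'I_n -> 'I_nlabels }.

Arguments llabel {R C n} _ _.
Arguments lassign {R C n} _ _.

Definition backbone_labeling (R : realType) (C : finType) (n : nat)
    (B : rectangle R) (P : n.-tuple (colored_point R C)) (L : labeling R C n) : Prop :=
  (forall l, ybottom B <= lheight (llabel L l) <= ytop B) /\
  (forall i, lcolor (llabel L (lassign L i)) = pcolor (tnth P i)).

Definition infinite_backbone (R : realType) (B : rectangle R) (h : R) :
    set (R * R) :=
  [set q | xleft B <= q.1 <= xright B /\ q.2 = h].

Definition vsegment (R : realType) (x y h : R) : set (R * R) :=
  [set q | q.1 = x /\ Num.min y h <= q.2 <= Num.max y h].

Definition leader (R : realType) (C : finType) (n : nat) (B : rectangle R)
    (P : n.-tuple (colored_point R C)) (L : labeling R C n) (l : 'I_(nlabels L)) :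
    set (R * R) :=
  infinite_backbone B (lheight (llabel L l)) `|`
  \bigcup_(i in [set i | lassign L i = l])
    vsegment (px (tnth P i)) (py (tnth P i)) (lheight (llabel L l)).

Definition crossing_free (R : realType) (C : finType) (n : nat)
    (B : rectangle R) (P : n.-tuple (colored_point R C)) (L : labeling R C n) : Prop :=
  forall l l' : 'I_(nlabels L), l <> l' -> leader B P l `&` leader B P l' = set0.

(* All backbones being infinite, the number of labels of a labeling is also its
   number of infinite backbones. *)
Definition minimum_labeling (R : realType) (C : finType) (n : nat)
    (B : rectangle R) (P : n.-tuple (colored_point R C)) (L : labeling R C n) : Prop :=
  [/\ backbone_labeling B P L,
      crossing_free B P L &
      forall L' : labeling R C n,
        backbone_labeling B P L' -> crossing_free B P L' ->
        (nlabels L <= nlabels L')%N].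

(** * A unit-cost real RAM

    Programs are closed syntax, independent of the colors, of the instance and
    of its size.  The memory consists of arrays of three kinds (naturals, reals,
    colors), each named by a constant occurring in the program and indexed by a
    computed natural; a scalar variable is a cell of an array at a constant
    index.  Naturals can only be incremented, decremented and compared, so that
    a run of t steps never manipulates numbers exceeding the input by more than
    O(t); there is no conversion between reals and naturals; colors can only be
    copied and tested for equality. *)

Inductive iexp :=
  | IConst of nat
  | IGet of nat & iexp
  | ISucc of iexp
  | IPred of iexp.

Inductive rexp :=
  | RConst of nat
  | RGet of nat & iexp
  | RAdd of rexp & rexp
  | RSub of rexp & rexp
  | RMul of rexp & rexp
  | RDiv of rexp & rexp.

Inductive bexp :=
  | BEqI of iexp & iexp
  | BLtI of iexp & iexp
  | BLtR of rexp & rexp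
  | BEqC of nat & iexp & nat & iexp
  | BNot of bexp
  | BAnd of bexp & bexp.

(* In the store instructions the first two arguments are the name and the index
   of the array cell that is written. *)
Inductive cmd :=
  | Skip
  | SetI of nat & iexp & iexp
  | SetR of nat & iexp & rexp
  | CopyC of nat & iexp & nat & iexp
  | Seq of cmd & cmd
  | If of bexp & cmd & cmd
  | While of bexp & cmd.

(* A color cell holding [None] is blank. *)
Record memory (R : realType) (C : finType) := Memory {
  imem : nat -> nat -> nat;
  rmem : nat -> nat -> R;
  cmem : nat -> nat -> option C }.

Definition update (T : Type) (m : nat -> nat -> T) (a k : nat) (v : T) :
    nat -> nat -> T :=
  fun a' k' => if (a' == a) && (k' == k) then v else m a' k'.

Section Semantics.
Variables (R : realType) (C : finType).
Implicit Types s : memory R C.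

Fixpoint ieval s (e : iexp) : nat :=
  match e with
  | IConst k => k
  | IGet a e1 => imem s a (ieval s e1)
  | ISucc e1 => (ieval s e1).+1
  | IPred e1 => (ieval s e1).-1
  end.

Fixpoint reval s (e : rexp) : R :=
  match e with
  | RConst k => k%:R
  | RGet a e1 => rmem s a (ieval s e1)
  | RAdd e1 e2 => reval s e1 + reval s e2
  | RSub e1 e2 => reval s e1 - reval s e2
  | RMul e1 e2 => reval s e1 * reval s e2
  | RDiv e1 e2 => reval s e1 / reval s e2
  end.

Fixpoint beval s (b : bexp) : bool :=
  match b with
  | BEqI e1 e2 => ieval s e1 == ieval s e2
  | BLtI e1 e2 => (ieval s e1 < ieval s e2)%N
  | BLtR e1 e2 => reval s e1 < reval s e2
  | BEqC a1 e1 a2 e2 => cmem s a1 (ieval s e1) == cmem s a2 (ieval s e2)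
  | BNot b1 => ~~ beval s b1
  | BAnd b1 b2 => beval s b1 && beval s b2
  end.

End Semantics.

(* Every constant, memory access, arithmetic operation, comparison and boolean
   connective costs one step. *)
Fixpoint icost (e : iexp) : nat :=
  match e with
  | IConst _ => 1
  | IGet _ e1 | ISucc e1 | IPred e1 => (icost e1).+1
  end.

Fixpoint rcost (e : rexp) : nat :=
  match e with
  | RConst _ => 1
  | RGet _ e1 => (icost e1).+1
  | RAdd e1 e2 | RSub e1 e2 | RMul e1 e2 | RDiv e1 e2 =>
      (rcost e1 + rcost e2).+1
  end.

Fixpoint bcost (b : bexp) : nat :=
  match b with
  | BEqI e1 e2 | BLtI e1 e2 => (icost e1 + icost e2).+1
  | BLtR e1 e2 => (rcost e1 + rcost e2).+1
  | BEqC _ e1 _ e2 => (icost e1 + icost e2).+3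
  | BNot b1 => (bcost b1).+1
  | BAnd b1 b2 => (bcost b1 + bcost b2).+1
  end.

(* [exec c s t s'] : started in memory s, the program c halts after t steps in
   memory s'. *)
Inductive exec (R : realType) (C : finType) :
    cmd -> memory R C -> nat -> memory R C -> Prop :=
  | ExecSkip s : exec Skip s 1 s
  | ExecSetI a i e s :
      exec (SetI a i e) s (icost i + icost e).+1
        (Memory (update (imem s) a (ieval s i) (ieval s e)) (rmem s) (cmem s))
  | ExecSetR a i e s :
      exec (SetR a i e) s (icost i + rcost e).+1
        (Memory (imem s) (update (rmem s) a (ieval s i) (reval s e)) (cmem s))
  | ExecCopyC a i b j s :
      exec (CopyC a i b j) s (icost i + icost j).+2
        (Memory (imem s) (rmem s)
           (update (cmem s) a (ieval s i) (cmem s b (ieval s j))))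
  | ExecSeq c1 c2 s t1 s1 t2 s2 :
      exec c1 s t1 s1 -> exec c2 s1 t2 s2 -> exec (Seq c1 c2) s (t1 + t2) s2
  | ExecIfTrue b c1 c2 s t s1 :
      beval s b -> exec c1 s t s1 -> exec (If b c1 c2) s (bcost b + t).+1 s1
  | ExecIfFalse b c1 c2 s t s1 :
      ~~ beval s b -> exec c2 s t s1 -> exec (If b c1 c2) s (bcost b + t).+1 s1
  | ExecWhileFalse b c s :
      ~~ beval s b -> exec (While b c) s (bcost b).+1 s
  | ExecWhileTrue b c s t1 s1 t2 s2 :
      beval s b -> exec c s t1 s1 -> exec (While b c) s1 t2 s2 ->
      exec (While b c) s (bcost b + t1 + t2).+1 s2.

Lemma exec_det (R : realType) (C : finType) (c : cmd) (s : memory R C)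
    (t t' : nat) (s1 s1' : memory R C) :
  exec c s t s1 -> exec c s t' s1' -> t = t' /\ s1 = s1'.
Proof.
move=> H; move: t' s1'; elim: H => {c s t s1}.
- by move=> s t' s' H; inversion H.
- by move=> a i e s t' s' H; inversion H.
- by move=> a i e s t' s' H; inversion H.
- by move=> a i b j s t' s' H; inversion H.
- move=> c1 c2 s t1 s1 t2 s2 _ IH1 _ IH2 t' s' H; inversion H as
    [| | | |? ? ? ? ? ? ? h1 h2| | | |]; subst.
  have [? ?] := IH1 _ _ h1; subst.
  by have [-> ->] := IH2 _ _ h2.
- move=> b c1 c2 s t s1 hb _ IH t' s' H; inversion H as
    [| | | | |? ? ? ? ? ? h h1|? ? ? ? ? ? h h1| |]; subst.
    by have [-> ->] := IH _ _ h1.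
  by rewrite hb in h.
- move=> b c1 c2 s t s1 hb _ IH t' s' H; inversion H as
    [| | | | |? ? ? ? ? ? h h1|? ? ? ? ? ? h h1| |]; subst.
    by rewrite h in hb.
  by have [-> ->] := IH _ _ h1.
- move=> b c s hb t' s' H; inversion H as
    [| | | | | | |? ? ? h|? ? ? ? ? ? ? h h1 h2]; subst => //.
  by rewrite h in hb.
- move=> b c s t1 s1 t2 s2 hb _ IH1 _ IH2 t' s' H; inversion H as
    [| | | | | | |? ? ? h|? ? ? ? ? ? ? h h1 h2]; subst.
    by rewrite hb in h.
  have [? ?] := IH1 _ _ h1; subst.
  by have [-> ->] := IH2 _ _ h2.
Qed.

(* Input conventions: natural array 0 holds n in its cell 0; real arrays 0 and 1
   hold the x- and y-coordinates and color array 0 the colors of the points, in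
   the given order; real array 2 holds the four sides of the rectangle.  All
   other cells are zero or blank. *)
Definition input_memory (R : realType) (C : finType) (n : nat)
    (B : rectangle R) (P : n.-tuple (colored_point R C)) : memory R C :=
  Memory
    (fun a k => if (a == 0) && (k == 0) then n else 0)%N
    (fun a k => match a with
                | 0 => oapp (@px R C) 0 (onth P k)
                | 1 => oapp (@py R C) 0 (onth P k)
                | 2 => nth 0 [:: xleft B; xright B; ybottom B; ytop B] k
                | _ => 0
                end)
    (fun a k => if a == 0 then omap (@pcolor R C) (onth P k) else None).

(* Output conventions: natural array 1 holds the number of labels in its cell 0;
   natural array 2 the label of each point; natural array 3 the side, real array
   3 the height and color array 1 the color of each label. *)
Definition output_memory (R : realType) (C : finType) (n : nat)
    (s : memory R C) (L : labeling R C n) : Prop :=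
  [/\ imem s 1 0 = nlabels L,
      forall i : 'I_n, imem s 2 i = lassign L i &
      forall l : 'I_(nlabels L),
        [/\ imem s 3 l = lright (llabel L l),
            rmem s 3 l = lheight (llabel L l) &
            cmem s 1 l = Some (lcolor (llabel L l))]].

(* Main.v *)
(** Since leaders are vertical, a point is joined to the backbone directly above
    it or to the one directly below it.  So a labeling is a list b_1, ..., b_K of
    backbone colors, from top to bottom, cutting the points into slabs such that
    every point of the slab between b_t and b_(t+1) has one of these two colors.
    Any such list can be drawn by halving gaps, except that no backbone fits above
    a point of the top side of the rectangle, or below one of the bottom side.

    Call (b_t, b_(t+1)) a state of a point of slab t, of cost t + 1.  If m is the
    least cost of a state at the current point, then every state has cost at most
    m + 2, so it suffices to know the states of cost m and m + 1, and these are
    described by boundedly many colors.  A phase is a maximal run of points with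
    the same m; at most two colors occur in it, and m grows by one from a phase to
    the next.  The minimum number of backbones is the number of phases, plus one
    when the last point lies on the bottom side and no cheapest state ends with its
    color.  The colors of the backbones are recovered from the last phase to the
    first, and a greedy top-down pass then places them. *)

Require Import Defs.
From mathcomp Require Import all_boot all_order all_algebra.
From mathcomp Require Import boolp classical_sets functions reals topology normedtype.
From mathcomp Require Import sequences landau.
From mathcomp Require Import zify lra.

Set Implicit Arguments.
Unset Strict Implicit.
Unset Printing Implicit Defensive.

Import Order.TTheory GRing.Theory Num.Theory.
Import numFieldNormedType.Exports.

(** * Phases and palettes *)

Section Phases.
Variable C : eqType.
Local Notation D := (option C).
Implicit Types (z r : D) (l rb : seq D) (T Bt : bool).

(* [None] is a blank register, and also the color "above the topmost backbone".
   [sx] is the color of the first point of the current phase, [sy] its other color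
   (blank while there is none), and (a, f) stands for the colors of the backbones
   above and below the current point.  While [sy] is blank, the cheapest states are
   (g, sx) with g in {sg1, sg2}, and (sx, se).  Afterwards they are those of
   (sy, sx) and (sx, sy) whose second component is in {sg1, sg2}, and (se, sy) can
   be had for one more backbone until the color [sx] comes back.
   [tab] has one entry (q, u, v) for each phase but the first, the latest phase
   first: if the backbone of the phase has color q, then the backbone of the
   previous phase gets the color u, otherwise v. *)
Record scan_state := Scan {
  sx : D; sy : D; sg1 : D; sg2 : D; se : D; tab : seq (D * D * D) }.

(** The entry of the current phase is revised when its second color is accepted: from then on a
    cheapest state consists of the two colors of the phase. *)
Definition mark (E : Type) (h : E) tb := if tb is _ :: tb' then h :: tb' else [::].

Lemma size_mark (E : Type) (h : E) tb : size (mark h tb) = size tb.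
Proof. by case: tb. Qed.

(* [T] says that the topmost point lies on the top side.  Its phase then starts as
   a two-colored one whose colors coincide, so that no backbone of another color
   can be put above the point. *)
Definition scan_start T z :=
  if T then Scan z z z None None [::] else Scan z None None None None [::].

(** The phase goes on as long as some cheapest state contains the new color. Otherwise the cost
    rises by one: the new cheapest states put [z] below a former cheapest state, or are former
    states of that cost with [z] as upper color, whose lower color is the new [se]. *)
Definition scan_step st z :=
  let: Scan x y g1 g2 e tb := st in
  if z == x then Scan x y g1 g2 (if y == None then e else None) tb
  else if z == y then st
  else if (y == None) && ((z == g1) || (z == g2) || (z == e)) then
    Scan x z (if (z == g1) || (z == g2) then x else z)
      (if z == e then z else x) (if z == e then None else e)
      (mark (x, z, x) tb)
  else if y == None then Scan z None x e x ((x, z, x) :: tb)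
  else let e' := if z == e then y else None in
    Scan z None g1 g2 e' ((e', z, g1) :: tb).

Fixpoint scan T l :=
  if l is z :: l' then
    if l' is [::] then scan_start T z else scan_step (scan T l') z
  else scan_start T None.

Fixpoint back r (tb : seq (D * D * D)) :=
  r :: (if tb is (q, u, v) :: tb' then back (if r == q then u else v) tb'
        else [::]).

(* In [slabs T l rb] both lists are reversed: [l] has the latest point first, [rb]
   the lowest backbone first, and the latest point is in the slab of the two
   lowest backbones. *)
Definition hit z rb := (z == nth None rb 0) || (z == nth None rb 1).

Inductive slabs T : seq D -> seq D -> Prop :=
  | Slabs1 z rb : hit z rb -> (T -> size rb <= 1) -> slabs T [:: z] rb
  | SlabsS z l s rb : slabs T l rb -> hit z (s ++ rb) ->
      slabs T (z :: l) (s ++ rb).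

(* Invariant of the lower bound: a prefix of the points drawn with [K] backbones,
   the two lowest of colors [f] and [a] (from below), cannot beat the scan. *)
Definition scan_bound st K f a :=
  let: Scan x y g1 g2 e tb := st in
  let k := size tb in
  [/\ x <> None, k < K &
  if y == None then
    [/\ f = x \/ a = x & K = k.+1 ->
      (f = x /\ (a = g1 \/ a = g2)) \/ (a = x /\ f = e)]
  else
    [/\ (g1 = x \/ g1 = y \/ g1 = None) /\ (g2 = x \/ g2 = y \/ g2 = None) /\
         (x = y -> e = None),
       K = k.+1 -> (f = g1 \/ f = g2) /\ (a = x \/ a = y \/ a = None) &
       K = k.+2 -> (a = g1 \/ a = g2) \/ (a = x /\ f = y) \/ (a = y /\ f = x)
          \/ (a = e /\ f = y)]].

(** * Lower bound on the number of backbones *)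

Lemma scan_start_bound T z rb : z <> None ->
  hit z rb -> (T -> size rb <= 1) ->
  scan_bound (scan_start T z) (size rb) (nth None rb 0) (nth None rb 1).
Proof.
move=> zN hz hT; have rb0 : 0 < size rb.
  by case: rb hz {hT} => // /orP[]/eqP.
have {}hz : nth None rb 0 = z \/ nth None rb 1 = z.
  by case/orP: hz => /eqP ->; tauto.
case: T hT => [/(_ isT)|_]; rewrite /scan_start /scan_bound /=.
  case: rb hz rb0 => [|b [|b' rb]] //= hz _ _.
  rewrite (negPf (introN eqP zN)); split=> //; split=> //; intuition congruence.
split=> //; split=> //.
by case: rb hz {rb0} => [|b [|b' rb]] //= hz _; intuition congruence.
Qed.

Ltac case_congruence := repeat match goal with
  | H : _ /\ _ |- _ => destruct H
  | H : _ \/ _ |- _ => destruct H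
  end; subst; try congruence; try tauto; intuition congruence.

(** The next point stays in the slab, moves to the next one (whose upper backbone is the old lower
    one), or skips a slab; in the last case nothing is known of the colors, but two backbones have
    been paid for. *)
Lemma scan_step_bound st K f a K' f' a' z : z <> None ->
  scan_bound st K f a ->
  [\/ [/\ K' = K, f' = f & a' = a], K' = K.+1 /\ a' = f | K.+2 <= K'] ->
  f' = z \/ a' = z -> scan_bound (scan_step st z) K' f' a'.
Proof.
case: st => x y g1 g2 e tb zN [xN kK] H st' fa; rewrite /scan_step.
have kK1 : size tb < K' by case: st' => [[-> _ _]|[-> _]|]; lia.
have zN' := negPf (introN eqP zN).
case: (eqVneq z x) => [zx|/eqP zx]; last case: (eqVneq z y) => [zy|/eqP zy].
- move: H; case: (eqVneq y None) => [yN|/eqP yN] H.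
    by split => //; rewrite yN /= in H *; split; [case_congruence|move=> kK'];
      case: st' => [[? ? ?]|[? ?]|?]; try lia; case: H => H1 H2; subst; try (apply: H2; lia).
  split => //.
  rewrite (negPf (introN eqP yN)); case: H => H1 H2 H3; split=> [|kK'|kK'];
    first (by case_congruence);
    case: st' => [[? ? ?]|[? ?]|?]; try lia; subst; first exact: H2.
    by have {}H3 := H3 ltac:(lia); case_congruence.
  by have {}H2 := H2 ltac:(lia); case_congruence.
- have yN : y <> None by congruence.
  move: H; rewrite (negPf (introN eqP yN)) => -[H1 H2 H3].
  split=> //.
  rewrite (negPf (introN eqP yN)); split=> // kK';
    case: st' => [[? ? ?]|[? ?]|?]; try lia; subst; [exact: H2|exact: H3|].
  by have {}H2 := H2 ltac:(lia); case_congruence.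
case: (eqVneq y None) H => [yN|/eqP yN] /= H; last first.
  case: H => H1 H2 H3.
  (* No cheapest state contains [z], so the new point needs at least one backbone more. *)
  have zK : (size tb).+1 < K'.
    case: st' => [[? ? ?]|[? ?]|?]; try lia; subst.
    suff : K <> (size tb).+1 by lia.
    by move=> /H2; case_congruence.
  split=> //=; split => // kK'.
  case: st' => [[? ? ?]|[? ?]|?]; try lia; subst.
    by have {}H3 := H3 ltac:(lia); case: eqP => ze; case_congruence.
  by have {}H2 := H2 ltac:(lia); case: eqP => ze; case_congruence.
case: H => H1 H2.
case: ifP => [/orP zg|/norP[/norP[/eqP z1 /eqP z2] /eqP ze]]; last first.
  have zK : (size tb).+1 < K'.
    case: st' => [[? ? ?]|[? ?]|?]; try lia; subst.
    suff : K <> (size tb).+1 by lia.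
    by move=> /H2; case_congruence.
  split=> //=; split => // kK'.
  case: st' => [[? ? ?]|[? ?]|?]; try lia; subst.
    by case_congruence.
  by have {}H2 := H2 ltac:(lia); case_congruence.
rewrite /scan_bound size_mark zN'; split=> //.
split.
- have [z1|/eqP z1] := eqVneq z g1; have [z2|/eqP z2] := eqVneq z g2;
  have [ze|/eqP ze] := eqVneq z e => /=; case_congruence.
- move=> kK'; case: st' => [[? ? ?]|[? ?]|?]; try lia; subst.
  have {}H2 := H2 ltac:(lia).
  have [z1|/eqP z1] := eqVneq z g1; have [z2|/eqP z2] := eqVneq z g2;
  have [ze|/eqP ze] := eqVneq z e => /=; case_congruence.
- move=> kK'; case: st' => [[? ? ?]|[? ?]|?]; try lia; subst.
    by right; case_congruence.
  have {}H2 := H2 ltac:(lia).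
  have [z1|/eqP z1] := eqVneq z g1; have [z2|/eqP z2] := eqVneq z g2;
  have [ze|/eqP ze] := eqVneq z e => /=; case_congruence.
Qed.

(* [Bt] says that the last point, of color [z], lies on the bottom side, so that the
   lowest backbone must have color [z]. *)
Definition finish Bt st z :=
  let: Scan x y g1 g2 e tb := st in
  if (y == None) || (z == g1) || (z == g2) then back z tb
  else if Bt then z :: back g1 tb else back g1 tb.

Lemma slabs_bound T l rb : slabs T l rb -> None \notin l ->
  scan_bound (scan T l) (size rb) (nth None rb 0) (nth None rb 1).
Proof.
elim=> [z {}rb hz hT|z {}l s {}rb Hl IH hz].
  by rewrite inE => zN; apply: scan_start_bound hz hT; apply/eqP; rewrite eq_sym.
rewrite inE negb_or => /andP[zN lN].
case: l Hl {lN}IH (IH lN) => [|z' l] Hl _ IH; first by inversion Hl.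
apply: (scan_step_bound _ IH); first by apply/eqP; rewrite eq_sym.
  case: s {hz} => [|b [|b' s]] /=; [exact: Or31|exact: Or32|apply: Or33].
  by rewrite size_cat; lia.
by case/orP: hz => /eqP ->; tauto.
Qed.

Lemma size_back r tb : size (back r tb) = (size tb).+1.
Proof. by elim: tb r => //= -[[q u] v] tb IH r /=; rewrite IH. Qed.

(** [K] counts all labels of a competitor, [rb] lists those down to the slab of its last point. With
    as many labels as phases and the last point on the bottom side, the competitor would be in a
    cheapest state ending with [z]. *)
Lemma finish_min T Bt z l rb K : slabs T (z :: l) rb -> None \notin z :: l ->
  size rb <= K -> (Bt -> size rb = K -> nth None rb 0 = z) ->
  size (finish Bt (scan T (z :: l)) z) <= K.
Proof.
move=> Hs zl rbK hB; have := slabs_bound Hs zl.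
have zN : z <> None by move=> zN; rewrite zN inE eqxx in zl.
case: (scan T _) => x y g1 g2 e tb [xN kr] /=.
case: (eqVneq y None) => [yN|/eqP yN] /=.
  by rewrite size_back => _; lia.
case: ifP => [_ _|/norP[/eqP z1 /eqP z2] [_ H2 _]]; first by rewrite size_back; lia.
case: Bt hB => [/(_ isT) hB|_]; rewrite /= size_back; last lia.
have [//|rbk] := ltnP (size tb).+1 (size rb); first by lia.
suff : size rb <> K by lia.
by move=> /[dup] /hB ? ?; case: H2; [lia|case_congruence].
Qed.

(* Invariant of the upper bound: the states announced by the registers are reached
   by the palettes that [back] recovers from the table. *)
Definition scan_feasible T st l :=
  let: Scan x y g1 g2 e tb := st in
  if y == None then
    [/\ tb = [::] -> [/\ g1 = None, g2 = None & e = None],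
        forall a tb' t, tb = t :: tb' -> a = g1 \/ a = g2 -> a <> None ->
          slabs T l (x :: back a tb'),
        slabs T l (back x tb),
        e <> None -> exists v tb',
          [/\ e <> x, tb = (e, x, v) :: tb' & slabs T l (e :: back x tb')] &
        forall h, h <> None -> slabs T l (x :: back h tb)]
  else
    [/\ g1 <> None /\ (tb = [::] /\ y = x /\ e = None \/ exists tb', tb = (x, y, x) :: tb'),
        (g1 = x \/ g1 = y) /\ (g2 = x \/ g2 = y \/ g2 = None),
        forall f, f = g1 \/ f = g2 -> f <> None -> slabs T l (back f tb) &
        e <> None -> slabs T l (y :: back e tb)].

(** * Upper bound: palettes recovered from the table *)

Definition tab_wf (tb : seq (D * D * D)) :=
  all (fun t => (t.1.2 != None) && (t.2 != None)) tb.

Lemma slabs0 T l rb z : slabs T l rb -> hit z rb -> slabs T (z :: l) rb.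
Proof. by move=> H hz; apply: (SlabsS (s := [::])). Qed.

Lemma slabs1 T l rb z h : slabs T l rb -> hit z (h :: rb) -> slabs T (z :: l) (h :: rb).
Proof. by move=> H hz; apply: (SlabsS (s := [:: h])). Qed.

Lemma slabs2 T l rb z h h' : slabs T l rb -> hit z (h :: h' :: rb) ->
  slabs T (z :: l) (h :: h' :: rb).
Proof. by move=> H hz; apply: (SlabsS (s := [:: h; h'])). Qed.

(** The last point can be moved one slab down, except when it is the only one and [T] holds it in
    the top slab. *)
Lemma slabs_last T z l rb h : slabs T (z :: l) rb -> (T -> l <> [::]) -> hit z (h :: rb) ->
  slabs T (z :: l) (h :: rb).
Proof.
move=> H hT hz; inversion H; subst.
  by apply: Slabs1 => // /hT.
by rewrite -cat_cons; apply: SlabsS.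
Qed.

Lemma nth_back r tb : nth None (back r tb) 0 = r.
Proof. by case: tb. Qed.

Lemma scan_start_feasible T z : z <> None -> scan_feasible T (scan_start T z) [:: z].
Proof.
move=> zN; rewrite /scan_start; case: T => /=.
  rewrite (negPf (introN eqP zN)); split=> //; [by split=> //; left|by tauto|].
  by move=> f [->|->] // _; apply: Slabs1; rewrite /hit /= ?eqxx.
split=> //; first by apply: Slabs1; rewrite /hit /= ?eqxx.
by move=> h hN; apply: Slabs1; rewrite /hit /= ?eqxx.
Qed.

(** Every state announced after the step arises from one announced before by staying in the slab or
    by adding one or two backbones below it: the moves [slabs0], [slabs1], [slabs2]. *)
Lemma scan_step_feasible T st l z : z <> None -> sx st <> None ->
  scan_feasible T st l -> scan_feasible T (scan_step st z) (z :: l).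
Proof.
case: st => x y g1 g2 e tb zN /= xN.
have zN' := negPf (introN eqP zN).
have hitl r rb : hit r (r :: rb) by rewrite /hit eqxx.
have hitr r b tb' : hit r (b :: back r tb') by rewrite /hit /= nth_back eqxx orbT.
case: (eqVneq z x) => [zx|/eqP zx]; last case: (eqVneq z y) => [zy|/eqP zy].
- case: (eqVneq y None) => [->|/eqP yN] /=.
    case=> H0 H1 H2 H3 H4; split=> //.
    + by move=> a tb' t etb ag aN; apply: slabs0; [apply: H1 etb _ _|rewrite zx].
    + by apply: slabs0 => //; rewrite /hit nth_back zx eqxx.
    + move=> /H3 [v [tb' [ex etb H]]]; exists v, tb'; split=> //.
      by apply: slabs0 => //; rewrite zx.
    + by move=> h /H4 H; apply: slabs0 => //; rewrite zx.
  rewrite (negPf (introN eqP yN)) => -[[g1N H0] Hg H1 H2]; split=> //.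
    by case: H0; tauto.
  move=> f fg fN; apply: slabs0; first exact: H1.
  rewrite zx; case: H0 => [[-> [yx _]]|[tb' ->]] /=.
    by have -> : f = x by case_congruence.
  by case: eqP => [->|fx] //.
- have yN : y <> None by congruence.
  rewrite /= (negPf (introN eqP yN)) => -[[g1N H0] Hg H1 H2]; split=> //.
    move=> f fg fN; apply: slabs0; first exact: H1.
    case: H0 => [[-> [yx _]]|[tb' ->]] /=; first by exfalso; congruence.
    case: eqP => [->|fx]; first by rewrite zy.
    by have -> : f = z by case_congruence.
  by move=> /H2 H; apply: slabs0 => //; rewrite zy.
rewrite /=; case: (eqVneq y None) => [yN|/eqP yN] /=; last first.
  case=> [[g1N H0] Hg H1 H2].
  have C1 := H1 g1 (or_introl erefl) g1N.
  have C2 : z = e -> slabs T (z :: l) (y :: back z tb).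
    by move=> ze; rewrite ze; apply: slabs0; [apply: H2; congruence|exact: hitr].
  split=> //.
  + move=> a tb' t [_ <-] ag aN; apply: slabs1 => //; exact: H1.
  + suff -> : (z == (if z == e then y else None)) = false by apply: slabs1.
    by apply/eqP; case: eqP.
  + case: eqP => // ze _; exists g1, tb; split=> //; [exact: nesym|exact: C2].
  + move=> h hN; case: (eqVneq h) => [|_]; last exact: slabs2.
    case: eqP => // ze ->.
    by apply: slabs1 => //; rewrite ze; apply: H2; congruence.
case=> H0 H1 H2 H3 H4.
case: ifP => [zg|/norP[/norP[/eqP z1 /eqP z2] /eqP ze]]; last first.
  split=> //.
  + move=> a tb' t [_ <-] [->|->] aN; apply: slabs1 => //.
    by have [v [tb2 [_ -> H]]] := H3 aN; rewrite /= eqxx.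
  + by rewrite /= (negPf (introN eqP zx)); apply: slabs1.
  + move=> _; exists x, tb; split=> //; first exact: nesym.
    by apply: slabs0; [exact: H4|].
  + move=> h hN; rewrite /=; case: (eqVneq h) => [->|_]; last exact: slabs2.
    by apply: slabs1; [exact: H4|].
have [t [tb' etb]] : exists t tb', tb = t :: tb'.
  case: (tb) H0 => [/(_ erefl)[g1N g2N eN]|t tb' _]; last by exists t, tb'.
  by move: zg; rewrite g1N g2N eN zN'.
rewrite etb /= zN'; split.
- split; last by right; exists tb'.
  by case: ifP.
- by split; case: ifP => _; tauto.
- have E1 : z = g1 \/ z = g2 -> slabs T (z :: l) (x :: back z tb').
    by move=> zg'; apply: slabs0; [exact: H1 etb zg' zN|exact: hitr].
  have E2 : z = e -> slabs T (z :: l) (z :: back x tb').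
    move=> ze; have [|v [tb2 []]] := H3; first by rewrite -ze.
    rewrite etb ze => _ [_ <-] H; exact: slabs0.
  move=> f ff fN; have [[-> zg']|[-> ze]] : (f = x /\ (z = g1 \/ z = g2)) \/ (f = z /\ z = e).
    move: ff zg; have [z1|/eqP z1] := eqVneq z g1; have [z2|/eqP z2] := eqVneq z g2;
    have [ze|/eqP ze] := eqVneq z e => //= ff _; case_congruence.
    by rewrite eqxx; apply: E1.
  by rewrite (negPf (introN eqP zx)); apply: E2.
- case: eqP => // ze eN; have [v [tb2 []]] := H3 eN.
  rewrite etb => ex [_ <-] H; rewrite (negPf (introN eqP ex)).
  exact: slabs1.
Qed.

Lemma scan_cons2 T z z' l :
  scan T [:: z, z' & l] = scan_step (scan T (z' :: l)) z.
Proof. by []. Qed.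

Definition scan_wf n st :=
  [/\ sx st != None, (sy st != None) ==> (sg1 st != None), tab_wf (tab st) &
      size (tab st) < n].

Lemma scan_is_wf T z l : None \notin z :: l ->
  scan_wf (size (z :: l)) (scan T (z :: l)).
Proof.
elim: l z => [|z' l IH] z; rewrite in_cons negb_or eq_sym => /andP[zN zl].
  by case: T; split; rewrite /= ?zN.
have {IH} := IH z' zl; rewrite scan_cons2.
case: (scan T _) => x y g1 g2 e tb [/= xN g1N tw ts].
case: ifP => _; first by split=> //=; lia.
case: ifP => _; first by split=> //=; lia.
case: (eqVneq y None) g1N => [yN _|yN g1N] /=; last first.
  by split; rewrite /= ?zN ?tw ?(implyP g1N).
case: ifP => _; split; rewrite /= ?zN ?xN ?tw ?size_mark //=.
- by case: ifP => _; rewrite ?zN ?xN ?implybT.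
- by case: tb tw {ts} => //= t tb /andP[_ ->]; rewrite zN xN.
- exact: ltnW.
Qed.

Lemma scan_is_feasible T z l : None \notin z :: l ->
  scan_feasible T (scan T (z :: l)) (z :: l).
Proof.
elim: l z => [|z' l IH] z; rewrite in_cons negb_or eq_sym => /andP[/eqP zN zl].
  exact: scan_start_feasible.
apply: scan_step_feasible zN _ (IH _ zl).
by have [/eqP] := scan_is_wf T zl.
Qed.

Lemma back_some r tb : r != None -> tab_wf tb -> None \notin back r tb.
Proof.
elim: tb r => [|[[q u] v] tb IH] r rN /=; first by rewrite inE eq_sym.
move=> /andP[/= /andP[uN vN] tw]; rewrite in_cons negb_or eq_sym rN.
by apply: IH => //; case: ifP.
Qed.

Lemma finish_slabs T Bt z l (rb := finish Bt (scan T (z :: l)) z) :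
  None \notin z :: l ->
  [/\ slabs T (z :: l) rb, Bt -> nth None rb 0 = z, None \notin rb &
     size rb <= (size l).+2].
Proof.
move=> zl; have := scan_is_feasible T zl; have := scan_is_wf T zl.
have zN : z != None by apply/eqP => zN; rewrite zN inE eqxx in zl.
(* While [sy] is blank, all points of the current phase have the color [sx], the last one
   included. *)
have hx : sy (scan T (z :: l)) = None -> sx (scan T (z :: l)) = z.
  case: (l) => [|z' l']; first by case: (T).
  rewrite scan_cons2; case: (scan T _) => x y g1 g2 e tb /=.
  case: eqP => [->|_] //; case: eqP => [<-|_] /=; first by move/eqP: zN.
  case: ifP => _ /=; first by move/eqP: zN.
  by case: (y == None).
(* For a single point, either [sy] is blank or [sg1] is its color; so an extra backbone is only
   appended when there are at least two points. *)
have lN : sy (scan T (z :: l)) != None -> z != sg1 (scan T (z :: l)) -> l <> [::].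
  by case: (l) => //=; case: (T) => //=; rewrite eqxx.
rewrite {}/rb; case: (scan T _) hx lN => x y g1 g2 e tb /= hx lN [/= xN g1N tw ts].
case: (eqVneq y None) g1N hx => [yN _ hx|yN /= g1N _] /=.
  rewrite -(hx yN) => -[_ _ H _ _]; rewrite nth_back size_back.
  by split=> //; [exact: back_some|exact: ltnW].
case=> _ _ H _; case: ifP => [zg|zg].
  rewrite nth_back size_back; split=> //; [|exact: back_some|exact: ltnW].
  by apply: H; [case/orP: zg => /eqP ->; tauto|exact/eqP].
have {}H := H g1 (or_introl erefl) (elimN eqP g1N).
case: Bt => /=; rewrite ?inE size_back.
  rewrite negb_or eq_sym zN; split=> //; last exact: back_some.
  apply: slabs_last => //; last by rewrite /hit eqxx.
  by move=> _; apply: lN => //; case/norP: zg.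
by split=> //; [exact: back_some|exact: ltnW].
Qed.

End Phases.

Local Open Scope classical_set_scope.
Local Open Scope ring_scope.

(** * The program *)

Fixpoint iwrites c : seq nat :=
  match c with
  | SetI a _ _ => [:: a]
  | Seq c1 c2 | If _ c1 c2 => iwrites c1 ++ iwrites c2
  | While _ c => iwrites c
  | _ => [::]
  end.

Fixpoint rwrites c : seq nat :=
  match c with
  | SetR a _ _ => [:: a]
  | Seq c1 c2 | If _ c1 c2 => rwrites c1 ++ rwrites c2
  | While _ c => rwrites c
  | _ => [::]
  end.

Fixpoint cwrites c : seq nat :=
  match c with
  | CopyC a _ _ _ => [:: a]
  | Seq c1 c2 | If _ c1 c2 => cwrites c1 ++ cwrites c2
  | While _ c => cwrites c
  | _ => [::]
  end.

(* Meaningless on loops, for which [wp] below is [False]. *)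
Fixpoint max_cost c : nat :=
  match c with
  | Skip => 1
  | SetI _ i e => (icost i + icost e).+1
  | SetR _ i e => (icost i + rcost e).+1
  | CopyC _ i _ j => (icost i + icost j).+2
  | Seq c1 c2 => max_cost c1 + max_cost c2
  | If b c1 c2 => (bcost b + maxn (max_cost c1) (max_cost c2)).+1
  | While _ _ => 0
  end.

(** * Program runs: preconditions, time bounds and frames *)

Section Runs.
Variables (R : realType) (C : finType).
Implicit Types (s : memory R C) (Q : memory R C -> Prop).

Fixpoint wp c Q s : Prop :=
  match c with
  | Skip => Q s
  | SetI a i e =>
      Q (Memory (update (imem s) a (ieval s i) (ieval s e)) (rmem s) (cmem s))
  | SetR a i e =>
      Q (Memory (imem s) (update (rmem s) a (ieval s i) (reval s e)) (cmem s))
  | CopyC a i b j =>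
      Q (Memory (imem s) (rmem s)
           (update (cmem s) a (ieval s i) (cmem s b (ieval s j))))
  | Seq c1 c2 => wp c1 (wp c2 Q) s
  | If b c1 c2 => if beval s b then wp c1 Q s else wp c2 Q s
  | While _ _ => False
  end.

Definition runs c s N Q := exists t s', [/\ exec c s t s', (t <= N)%N & Q s'].

Lemma runs_wp c s Q : wp c Q s -> runs c s (max_cost c) Q.
Proof.
elim: c s Q => [|a i e|a i e|a i b j|c1 IH1 c2 IH2|b c1 IH1 c2 IH2|//] s Q /=.
- by exists 1%N, s; split=> //; constructor.
- by move=> H; do 2 eexists; split; [constructor| |exact: H].
- by move=> H; do 2 eexists; split; [constructor| |exact: H].
- by move=> H; do 2 eexists; split; [constructor| |exact: H].
- move=> /IH1 [t1 [s1 [e1 h1 /IH2 [t2 [s2 [e2 h2 H]]]]]].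
  by exists (t1 + t2)%N, s2; split=> //; [apply: ExecSeq e1 e2|lia].
- case: ifP => hb.
    move=> /IH1 [t1 [s1 [e1 h1 H]]]; exists (bcost b + t1).+1, s1.
    by split=> //; [exact: ExecIfTrue|lia].
  move=> /IH2 [t1 [s1 [e1 h1 H]]]; exists (bcost b + t1).+1, s1.
  by split=> //; [apply: ExecIfFalse; rewrite ?hb|lia].
Qed.

Lemma runs_weak c s N N' Q Q' : runs c s N Q -> (N <= N')%N ->
  (forall s', Q s' -> Q' s') -> runs c s N' Q'.
Proof.
move=> [t [s' [e h H]]] NN QQ; exists t, s'; split=> //; last exact: QQ.
exact: leq_trans h NN.
Qed.

Lemma runs_seq c1 c2 s N1 N2 Q1 Q2 : runs c1 s N1 Q1 ->
  (forall s', Q1 s' -> runs c2 s' N2 Q2) -> runs (Seq c1 c2) s (N1 + N2) Q2.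
Proof.
move=> [t1 [s1 [e1 h1 H1]]] /(_ _ H1) [t2 [s2 [e2 h2 H2]]].
by exists (t1 + t2)%N, s2; split=> //; [apply: ExecSeq e1 e2|lia].
Qed.

(** There are at most [m] iterations, since each decreases [mu]; the successor of [m] pays for the
    final failing test. *)
Lemma runs_while b c s N (I : memory R C -> Prop) (mu : memory R C -> nat) m :
  (forall s1, I s1 -> beval s1 b ->
     runs c s1 N (fun s2 => I s2 /\ (mu s2 < mu s1)%N)) ->
  I s -> (mu s <= m)%N ->
  runs (While b c) s ((bcost b + N).+1 * m.+1) (fun s' => I s' /\ ~~ beval s' b).
Proof.
move=> Hb; elim: m s => [|m IH] s Is ms; (have [hb|hb] := boolP (beval s b); last first).
- exists (bcost b).+1, s; split=> //; [exact: ExecWhileFalse|lia].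
- by have [t [s' [_ _ [_]]]] := Hb _ Is hb; lia.
- exists (bcost b).+1, s; split=> //; [exact: ExecWhileFalse|lia].
have [t1 [s1 [e1 h1 [Is1 ms1]]]] := Hb _ Is hb.
have [|t2 [s2 [e2 h2 H]]] := IH s1 Is1; first lia.
exists (bcost b + t1 + t2).+1, s2; split=> //; first exact: ExecWhileTrue e1 e2.
by rewrite mulnS; lia.
Qed.

Lemma exec_frame c s t s' : exec c s t s' ->
  [/\ forall a k, a \notin iwrites c -> imem s' a k = imem s a k,
      forall a k, a \notin rwrites c -> rmem s' a k = rmem s a k &
      forall a k, a \notin cwrites c -> cmem s' a k = cmem s a k].
Proof.
elim=> {c s t s'} //=.
1-3: by move=> *; split=> // a' k; rewrite inE /update => /negPf ->.
- move=> c1 c2 s t1 s1 t2 s2 _ [i1 r1 c1'] _ [i2 r2 c2'].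
  by split=> a k; rewrite mem_cat negb_or => /andP[n1 n2];
    rewrite ?i2 ?i1 ?r2 ?r1 ?c2' ?c1'.
- move=> b c1 c2 s t s1 _ _ [i1 r1 c1'].
  by split=> a k; rewrite mem_cat negb_or => /andP[n1 n2]; rewrite ?i1 ?r1 ?c1'.
- move=> b c1 c2 s t s1 _ _ [i1 r1 c1'].
  by split=> a k; rewrite mem_cat negb_or => /andP[n1 n2]; rewrite ?i1 ?r1 ?c1'.
- move=> b c s t1 s1 t2 s2 _ _ [i1 r1 c1'] _ [i2 r2 c2'].
  by split=> a k n1; rewrite ?i2 ?i1 ?r2 ?r1 ?c2' ?c1'.
Qed.

Lemma runs_frame c s N Q : runs c s N Q ->
  runs c s N (fun s' => Q s' /\
    [/\ forall a k, a \notin iwrites c -> imem s' a k = imem s a k,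
        forall a k, a \notin rwrites c -> rmem s' a k = rmem s a k &
        forall a k, a \notin cwrites c -> cmem s' a k = cmem s a k]).
Proof.
move=> [t [s' [e h H]]]; exists t, s'; split=> //; split=> //.
exact: exec_frame e.
Qed.

End Runs.

(* Scalar cells: natural arrays 4 (current point), 5 (current phase) and 6 (current
   backbone); color arrays 2 to 6 (registers [sx], [sy], [sg1], [sg2], [se]) and 7
   (always blank); real array 4 (height below which the next backbone must lie).
   Color arrays 8 to 10 hold [tab], indexed by the phases counted from 0. *)
Notation ivar a := (IGet a (IConst 0)).
Notation icopy a b := (CopyC a (IConst 0) b (IConst 0)).
Notation csame a i b := (BEqC a i b (IConst 0)).
Notation bor b1 b2 := (BNot (BAnd (BNot b1) (BNot b2))).
Definition incr a := SetI a (IConst 0) (ISucc (ivar a)).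

Definition zis a := csame 0 (ivar 4) a.
Definition blank a := BEqC a (IConst 0) 7 (IConst 0).

Definition accept_code :=
  Seq (CopyC 3 (IConst 0) 0 (ivar 4))
  (Seq (If (bor (zis 4) (zis 5)) (icopy 4 2) (CopyC 4 (IConst 0) 0 (ivar 4)))
  (Seq (If (zis 6) (Seq (CopyC 5 (IConst 0) 0 (ivar 4)) (icopy 6 7)) (icopy 5 2))
  (Seq (CopyC 8 (ivar 5) 2 (IConst 0))
  (Seq (CopyC 9 (ivar 5) 0 (ivar 4))
       (CopyC 10 (ivar 5) 2 (IConst 0)))))).

(** In both cases of [scan_step] that open a phase, the new entry consists of the new [se], [sx] and
    [sg1], so the last three copies are shared. *)
Definition phase_code :=
  Seq (incr 5)
  (Seq (If (blank 3) (Seq (icopy 5 6) (Seq (icopy 4 2) (icopy 6 2)))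
         (Seq (If (zis 6) (icopy 6 3) (icopy 6 7)) (icopy 3 7)))
  (Seq (CopyC 2 (IConst 0) 0 (ivar 4))
  (Seq (CopyC 8 (ivar 5) 6 (IConst 0))
  (Seq (CopyC 9 (ivar 5) 0 (ivar 4))
       (CopyC 10 (ivar 5) 4 (IConst 0)))))).

Definition scan_body :=
  Seq
    (If (zis 2) (If (blank 3) Skip (icopy 6 7))
    (If (zis 3) Skip
    (If (BAnd (blank 3) (bor (bor (zis 4) (zis 5)) (zis 6))) accept_code
        phase_code)))
    (incr 4).

Definition init_code :=
  Seq (CopyC 2 (IConst 0) 0 (IConst 0))
  (Seq (If (BLtR (RGet 1 (IConst 0)) (RGet 2 (IConst 3))) Skip
            (Seq (icopy 3 2) (icopy 4 2)))
       (SetI 4 (IConst 0) (IConst 1))).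

Definition before_end := BLtI (ivar 4) (ivar 0).

Definition ends_with a := BEqC 0 (IPred (ivar 0)) a (IConst 0).

(** An extra lowest backbone is entered as one more phase whose table entry sends every color to
    [sg1]; the color recovery then needs no special case. *)
Definition finish_code :=
  Seq (If (bor (bor (blank 3) (ends_with 4)) (ends_with 5))
         (CopyC 1 (ivar 5) 0 (IPred (ivar 0)))
      (If (BLtR (RGet 2 (IConst 2)) (RGet 1 (IPred (ivar 0))))
         (CopyC 1 (ivar 5) 4 (IConst 0))
      (Seq (incr 5)
      (Seq (CopyC 8 (ivar 5) 7 (IConst 0))
      (Seq (CopyC 9 (ivar 5) 4 (IConst 0))
      (Seq (CopyC 10 (ivar 5) 4 (IConst 0))
           (CopyC 1 (ivar 5) 0 (IPred (ivar 0)))))))))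
  (Seq (SetI 1 (IConst 0) (ISucc (ivar 5)))
       (SetI 6 (IConst 0) (ivar 5))).

Definition color_test := BLtI (IConst 0) (ivar 6).

Definition color_body :=
  Seq (If (BEqC 1 (ivar 6) 8 (ivar 6))
         (CopyC 1 (IPred (ivar 6)) 9 (ivar 6))
         (CopyC 1 (IPred (ivar 6)) 10 (ivar 6)))
      (SetI 6 (IConst 0) (IPred (ivar 6))).

Definition place_init :=
  Seq (SetI 4 (IConst 0) (IConst 0)) (SetR 4 (IConst 0) (RGet 2 (IConst 3))).

Definition half e := RDiv (RAdd (RGet 4 (IConst 0)) e) (RConst 2).

(* At backbone 0 the predecessor is 0 again, which makes the second color test
   harmless.  The last point is delayed to the last slab, so that only one backbone
   remains to be put below it. *)
Definition place_body :=
  If (BAnd (bor (BEqC 0 (ivar 4) 1 (ivar 6)) (BEqC 0 (ivar 4) 1 (IPred (ivar 6))))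
           (bor (BLtI (ISucc (ivar 4)) (ivar 0)) (BEqI (ivar 6) (ivar 5))))
    (Seq (If (BEqC 0 (ivar 4) 1 (ivar 6))
            (SetI 2 (ivar 4) (ivar 6)) (SetI 2 (ivar 4) (IPred (ivar 6))))
    (Seq (SetR 4 (IConst 0) (RGet 1 (ivar 4))) (incr 4)))
    (Seq (SetR 3 (ivar 6) (half (RGet 1 (ivar 4))))
    (Seq (SetR 4 (IConst 0) (RGet 3 (ivar 6))) (incr 6))).

Definition place_end := SetR 3 (ivar 6) (half (RGet 2 (IConst 2))).

(** Without points, the initial memory already describes the labeling without labels. *)
Definition label_code :=
  If (BLtI (IConst 0) (ivar 0))
    (Seq init_code
    (Seq (While before_end scan_body)
    (Seq finish_code
    (Seq (While color_test color_body)
    (Seq place_init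
    (Seq (While before_end place_body) place_end))))))
    Skip.

(** * Correctness of the scan and of the color recovery *)

Section Passes.
Variables (R : realType) (C : finType).
Implicit Types (s : memory R C).
Notation D := (option C).

Fixpoint holds_table s (tb : seq (D * D * D)) :=
  if tb is t :: tb' then
    [/\ cmem s 8 (size tb) = t.1.1, cmem s 9 (size tb) = t.1.2,
        cmem s 10 (size tb) = t.2 & holds_table s tb']
  else True.

Lemma holds_table_ext s s' tb :
  (forall a k, (a \in [:: 8; 9; 10])%N -> (k <= size tb)%N ->
     cmem s' a k = cmem s a k) -> holds_table s tb -> holds_table s' tb.
Proof.
elim: tb => //= t tb IH H [h1 h2 h3 h4]; rewrite !H //; split=> //.
by apply: IH h4 => a k ha hk; apply: H => //; lia.
Qed.

Definition holds_scan s i (st : scan_state C) :=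
  let: Scan x y g1 g2 e tb := st in
  [/\ imem s 4 0 = i, imem s 5 0 = size tb, holds_table s tb &
   [/\ cmem s 2 0 = x, cmem s 3 0 = y, cmem s 4 0 = g1, cmem s 5 0 = g2 &
       cmem s 6 0 = e]].

Lemma scan_body_runs s i st : holds_scan s i st -> cmem s 7 0 = None ->
  wp scan_body (fun s' => holds_scan s' i.+1 (scan_step st (cmem s 0 i))) s.
Proof.
case: st => x y g1 g2 e tb [h4 h5 ht [hx hy hg1 hg2 he]] h7.
rewrite /scan_body /= h4 hx hy hg1 hg2 he h7; set z := cmem s 0 i.
have upd tb' k (m : memory R C) : (size tb' < k)%N -> holds_table s tb' ->
    (forall a k', (a \in [:: 8; 9; 10])%N -> (k' < k)%N -> cmem m a k' = cmem s a k') ->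
    holds_table m tb'.
  by move=> tk ht' H; apply: holds_table_ext ht' => a k' ha hk; apply: H; lia.
case: (z == x).
  case: (y == None); rewrite /update /=; split=> //=; apply: upd ht _ => // a k;
    by rewrite !inE /update => /or3P[]/eqP->.
case: (z == y).
  by rewrite /update /=; split=> //=; apply: upd ht _ => // a k; rewrite !inE => /or3P[]/eqP->.
rewrite !negb_and !negbK; case: (eqVneq y None) hy => [yN|yN] hy; rewrite /= /update /=.
  rewrite hx hg1 hg2 he -/z.
  case: ifP => [zg|->].
    rewrite zg {zg}; case: (_ || _); case: (z == e); (split; rewrite /= ?size_mark ?h7 //;
    case: (tb) h5 ht => [|t tb'] //= h5 [_ _ _ ht]; rewrite h5 !eqxx /=; split=> //;
    apply: (upd _ _ _ (ltnSn _) ht) => a k;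
    by rewrite !inE => /or3P[]/eqP-> /= /ltn_eqF ->).
  rewrite h4 h5 -/z; split=> //=; last by rewrite hy.
  rewrite eqxx; split=> //; apply: (upd _ _ _ (ltnSn _) ht) => a k.
  by rewrite !inE => /or3P[]/eqP-> /= /ltn_eqF ->.
rewrite h4 h5 h7 hg1 hg2 -/z; case: (z == e); split=> //; rewrite eqxx; split=> //;
  (apply: (upd _ _ _ (ltnSn _) ht) => a k;
  by rewrite !inE => /or3P[]/eqP-> /= /ltn_eqF ->).
Qed.

Variables (n : nat) (col : nat -> D) (yy : nat -> R) (ybot ytp : R).

(** Besides the instance, this records that all sides stay 0, so that all labels lie on the same
    side, and that the blank color register stays blank. *)
Definition keeps_input s :=
  [/\ imem s 0 0 = n, forall k, cmem s 0 k = col k, forall k, rmem s 1 k = yy k &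
   [/\ rmem s 2 2 = ybot, rmem s 2 3 = ytp, forall k, imem s 3 k = 0%N &
       cmem s 7 0 = None]].

(** A boolean test on the syntax, so that preservation of the input is checked by computation for
    each pass. *)
Definition input_safe c :=
  [&& ~~ has (mem [:: 0; 3]%N) (iwrites c), ~~ has (mem [:: 1; 2]%N) (rwrites c) &
      ~~ has (mem [:: 0; 7]%N) (cwrites c)].

Lemma runs_keeps_input c s N Q : input_safe c -> keeps_input s -> runs c s N Q ->
  runs c s N (fun s' => keeps_input s' /\ Q s').
Proof.
move=> /and3P[/hasPn ci /hasPn cr /hasPn cc] [h1 h2 h3 [h4 h5 h6 h7]] /runs_frame H.
have ni a : (a \in [:: 0; 3]%N) -> a \notin iwrites c by apply/contraL/ci.
have nr a : (a \in [:: 1; 2]%N) -> a \notin rwrites c by apply/contraL/cr.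
have nc a : (a \in [:: 0; 7]%N) -> a \notin cwrites c by apply/contraL/cc.
apply: runs_weak H (leqnn _) _ => s' [HQ [fi fr fc]]; split=> //.
by split; [rewrite fi ?ni | move=> k; rewrite fc ?nc | move=> k; rewrite fr ?nr |
  split; [rewrite fr ?nr | rewrite fr ?nr | move=> k; rewrite fi ?ni | rewrite fc ?nc]].
Qed.

Let pts i := rev (mkseq col i).
Let attop := ~~ (yy 0 < ytp).
Let atbot := ~~ (ybot < yy n.-1).

Lemma init_runs s : keeps_input s -> (forall k, imem s 5 k = 0%N) ->
  (forall a k, (2 <= a <= 6)%N -> cmem s a k = None) ->
  runs init_code s (max_cost init_code)
    (fun s' => keeps_input s' /\ holds_scan s' 1 (scan attop (pts 1))).
Proof.
move=> ks i5 cN; apply: runs_keeps_input => //; apply: runs_wp.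
case: ks => [h1 h2 h3 [h4 h5 h6 h7]]; rewrite /= h3 h5 /attop.
case: (_ < _); rewrite /update /scan_start /=; split; rewrite //= ?i5 // ?h2 //.
  by split; rewrite //= ?cN.
by split; rewrite //= ?cN.
Qed.

Lemma pts_S i : pts i.+1 = col i :: pts i.
Proof. by rewrite /pts mkseqS rev_rcons. Qed.

Lemma scan_runs s : (0 < n)%N -> keeps_input s ->
  holds_scan s 1 (scan attop (pts 1)) ->
  runs (While before_end scan_body) s ((bcost before_end + max_cost scan_body).+1 * n.+1)
    (fun s' => keeps_input s' /\ holds_scan s' n (scan attop (pts n))).
Proof.
move=> n0 ks hs.
pose I s := keeps_input s /\ exists2 i, (0 < i <= n)%N & holds_scan s i (scan attop (pts i)).
pose mu s := (n - imem s 4 0)%N.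
have Is : I s by split=> //; exists 1%N.
apply: runs_weak (runs_while (I := I) (mu := mu) (m := n) _ Is _) _ _ => //.
- move=> s1 [ks1 [i ib hs1]].
  have i4 : imem s1 4 0 = i by case: (scan _ _) hs1 => ? ? ? ? ? ? [].
  have [h1 h2 _ [_ _ _ h7]] := ks1.
  rewrite /before_end [beval _ _]/= i4 h1 => lin; have := scan_body_runs hs1 h7 => /runs_wp.
  move=> /(runs_keeps_input (c := scan_body) isT ks1) H.
  apply: runs_weak H (leqnn _) _ => s2 [ks2 H].
  have i42 : imem s2 4 0 = i.+1 by case: (scan_step _ _) H => ? ? ? ? ? ? [].
  split; last by rewrite /mu i4 i42; lia.
  split=> //; exists i.+1; first by lia.
  move: H; rewrite h2 pts_S; case: i ib {hs1 i4 lin i42} => // i _.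
  by rewrite pts_S.
- by rewrite /mu; lia.
- move=> s' [[ks' [i ib hs']]]; have [h1 _ _ _] := ks'.
  have i4 : imem s' 4 0 = i by case: (scan _ _) hs' => ? ? ? ? ? ? [].
  rewrite /= i4 h1 => ni; split=> //.
  by have -> : n = i by lia.
Qed.

Definition holds_palette s r (tb : seq (D * D * D)) :=
  [/\ imem s 5 0 = size tb, imem s 1 0 = (size tb).+1, imem s 6 0 = size tb,
      cmem s 1 (size tb) = r & holds_table s tb].

Lemma finish_runs s st : keeps_input s -> holds_scan s n st ->
  runs finish_code s (max_cost finish_code) (fun s' => keeps_input s' /\
    exists r tb, holds_palette s' r tb /\ back r tb = finish atbot st (col n.-1)).
Proof.
move=> ks hs; apply: runs_keeps_input => //; apply: runs_wp.
case: ks => [h1 h2 h3 [h4 h5 h6 h7]].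
case: st hs => x y g1 g2 e tb [i4 i5 ht [hx hy hg1 hg2 he]].
rewrite /= h1 h2 hy hg1 hg2 h7 h3 h4 /atbot; set z := col n.-1.
have upd tb' (m : memory R C) : (size tb' <= size tb)%N -> holds_table s tb' ->
    (forall a k', (a \in [:: 8; 9; 10])%N -> (k' <= size tb)%N -> cmem m a k' = cmem s a k') ->
    holds_table m tb'.
  by move=> tk ht' H; apply: holds_table_ext ht' => a k' ha hk; apply: H; lia.
rewrite !negb_and !negbK; case: (_ || _) => /=.
  exists z, tb; split=> //; rewrite /update /= i5; split=> //=; rewrite ?i5 ?eqxx ?h1 ?h2 //.
  by apply: upd ht _ => // a k; rewrite !inE => /or3P[]/eqP->.
case: (_ < _) => /=.
  exists g1, tb; split=> //; rewrite /update /= i5; split=> //=; rewrite ?i5 ?eqxx ?h1 ?h2 //.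
  by apply: upd ht _ => // a k; rewrite !inE => /or3P[]/eqP->.
exists z, ((None, g1, g1) :: tb); split; last by rewrite /= if_same.
rewrite /update /= i5 h1 h2 hg1; split=> //=; rewrite ?eqxx //.
split=> //; apply: upd ht _ => // a k.
by rewrite !inE => /or3P[]/eqP-> /= hk; rewrite ?(ltn_eqF (_ : (k < (size tb).+1)%N)) ?ltnS.
Qed.

Lemma color_runs s r tb m (bk := back r tb) : keeps_input s -> holds_palette s r tb ->
  (size tb <= m)%N ->
  runs (While color_test color_body) s ((bcost color_test + max_cost color_body).+1 * m.+1)
    (fun s' => keeps_input s' /\ [/\ imem s' 5 0 = size tb, imem s' 1 0 = (size tb).+1,
       imem s' 6 0 = 0%N & forall j, (j <= size tb)%N -> cmem s' 1 j = nth None (rev bk) j]).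
Proof.
move=> ks [i5 i1 i6 c1 ht] tm.
(* [bk] lists the lowest backbone first, so backbone [j] from the top is its entry [size tb - j].
   The colors of index at least [size tb'] are written, and [back r' tb'] is the rest of [bk] from
   there upwards. *)
pose I s := keeps_input s /\ exists r' tb',
  [/\ imem s 5 0 = size tb, imem s 1 0 = (size tb).+1,
  imem s 6 0 = size tb', holds_table s tb' &
  [/\ (size tb' <= size tb)%N, forall j, (j <= size tb')%N ->
    nth None bk (size tb - j) = nth None (back r' tb') (size tb' - j) &
  forall j, (size tb' <= j <= size tb)%N -> cmem s 1 j = nth None bk (size tb - j)]].
have Is : I s.
  split=> //; exists r, tb; split=> //; split=> // j jj.
  have /eqP-> : j == size tb by rewrite eqn_leq andbC.
  by rewrite subnn c1 /bk; case: (tb).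
apply: runs_weak (runs_while (I := I) (mu := fun s => imem s 6 0) (m := m) _ Is _) _ _ => //.
- move=> s1 [ks1 [r' [tb' [j5 j1 j6 ht' [tt bb cc]]]]].
  rewrite /color_test [beval _ _]/= j6 => tb0.
  have c1' : cmem s1 1 (size tb') = r'.
    by rewrite cc ?leqnn // bb // subnn; case: (tb').
  case: tb' tb0 j6 ht' tt bb cc c1' => // [[[q u] v] tb'] _ /= j6 [t8 t9 t10 ht'] tt bb cc c1'.
  pose r2 := if r' == q then u else v.
  have H : runs color_body s1 (max_cost color_body) (fun s2 =>
     [/\ imem s2 5 0 = size tb, imem s2 1 0 = (size tb).+1,
        imem s2 6 0 = size tb', holds_table s2 tb' &
        forall j, cmem s2 1 j = if j == size tb' then r2 else cmem s1 1 j]).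
    apply: runs_wp; rewrite /= j6 /= c1' t8 t9 t10 /r2.
    case: (r' == q); rewrite /update /=; split=> //;
      by apply: holds_table_ext ht' => // a k; rewrite !inE => /or3P[]/eqP->.
  apply: runs_weak (runs_keeps_input (c := color_body) isT ks1 H) (leqnn _) _.
  move=> s2 [ks2 [k5 k1 k6 k8 k9]].
  split; last by rewrite k6.
  split=> //; exists r2, tb'; split=> //; split; first exact: ltnW.
    move=> j jt; rewrite bb; last exact: leqW.
    by rewrite subSn.
  move=> j /andP[tj jt]; rewrite k9; case: eqP => [->|/eqP jn].
    rewrite bb ?leqnSn // subSn // subnn /=.
    by case: (tb').
  by apply: cc; rewrite jt andbT ltn_neqAle eq_sym jn.
- by rewrite i6.
- move=> s' [[ks' [r' [tb' [j5 j1 j6 ht' [tt bb cc]]]]]]; rewrite /= j6 => tb0.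
  split=> //; split=> //; first by lia.
  move=> j jt; rewrite cc; last by rewrite jt andbT leqNgt; apply: contra tb0; case: (size tb').
  by rewrite nth_rev size_back.
Qed.

End Passes.

(** * Palettes and slab assignments *)

Section Fits.
Variable C : eqType.
Local Notation D := (option C).
Implicit Types (z : D) (l rb cs b : seq D) (T : bool) (t : nat -> nat).

(* [t i] is the slab of the i-th point, between the backbones [t i - 1] and [t i]
   counted from 0; for slab 0 the truncated subtraction merges the two. *)
Definition fits T cs b t :=
  [/\ forall i, (i < size cs)%N -> (t i < size b)%N /\
        ((nth None cs i == nth None b (t i)) || (nth None cs i == nth None b (t i).-1)),
      forall i, (i.+1 < size cs)%N -> (t i <= t i.+1)%N &
      T -> t 0%N = 0%N].

Lemma hit_rev z rb : z != None -> hit z rb -> (0 < size rb)%N /\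
  ((z == nth None (rev rb) (size rb).-1) || (z == nth None (rev rb) (size rb).-1.-1)).
Proof.
move=> zN; case: rb => [|f [|a rb]]; rewrite /hit /=.
- by rewrite orbb (negPf zN).
- by rewrite (negPf zN) orbF => /eqP ->; rewrite eqxx.
- by move=> h; rewrite !nth_rev //= ?subSS ?subnn ?subSnn.
Qed.

(** Each point is sent to the slab that is lowest when the point is added. Later points only append
    backbones below, so indices counted from the top do not change. *)
Lemma slabs_fits T l rb : slabs T l rb -> None \notin l ->
  exists t, fits T (rev l) (rev rb) t /\ t (size l).-1 = (size rb).-1.
Proof.
elim=> {l rb} [z rb hz hT|z l s rb Hl IH hz]; rewrite in_cons negb_or eq_sym => /andP[zN lN].
  have [rb0 {}hz] := hit_rev zN hz.
  exists (fun=> (size rb).-1); split=> //.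
  split=> //; last by move=> /hT; case: (size rb) => [|[]].
  by case=> // _; rewrite size_rev prednK.
have [t [[t1 t2 t3] t4]] := IH lN; have [srb {}hz] := hit_rev zN hz.
have l0 : (0 < size l)%N by case: Hl.
have rb0 : (0 < size rb)%N.
  by have [|] := t1 0%N; rewrite !size_rev //; lia.
have tle i : (i < size l)%N -> (t i < size rb)%N.
  by move=> il; have [|] := t1 i; rewrite size_rev.
exists (fun i => if (i < size l)%N then t i else (size (s ++ rb)).-1); split; last first.
  by rewrite /= ltnn.
rewrite rev_cons rev_cat; split.
- move=> i; rewrite size_rcons size_cat !size_rev nth_rcons size_rev ltnS => il.
  case: (ltnP i (size l)) => li.
    have [ti hi] := t1 i ltac:(by rewrite size_rev); rewrite size_rev in ti.
    split; first by rewrite size_cat !size_rev; lia.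
    by rewrite !nth_cat !size_rev ti (leq_ltn_trans (leq_pred _) ti).
  have -> : i = size l by lia.
  by rewrite eqxx -rev_cat -size_cat size_rev prednK.
- move=> i; rewrite size_rcons size_rev ltnS => il; rewrite il.
  case: (ltnP i.+1) => li; first by apply: t2; rewrite size_rev.
  by have := tle _ il; rewrite size_cat; lia.
- by rewrite l0.
Qed.

(** Only the backbones down to the slab of the current point are kept; those between two consecutive
    slabs form the [s] of [SlabsS]. *)
Lemma fits_slabs T cs b t : (0 < size cs)%N -> fits T cs b t ->
  slabs T (rev cs) (rev (take (t (size cs).-1).+1 b)).
Proof.
move=> c0 [t1 t2 t3].
suff H : forall i, (i < size cs)%N -> slabs T (rev (take i.+1 cs)) (rev (take (t i).+1 b)).
  by have := H (size cs).-1; rewrite prednK // take_size; apply.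
have hti i : (i < size cs)%N -> hit (nth None cs i) (rev (take (t i).+1 b)).
  move=> /t1 []; rewrite /hit; case: (t i) => [|m] tb.
    by rewrite orbb nth_rev ?size_takel // subnn nth_take // => ->.
  by rewrite !nth_rev ?size_takel // !subSS !subn0 !nth_take.
elim=> [|i IH] il.
  rewrite (take_nth None) // take0 /=; apply: Slabs1; first exact: hti.
  by move=> /t3 ->; rewrite size_rev size_take; case: ifP => //; case: (b) => [|? []].
have -> : rev (take i.+2 cs) = nth None cs i.+1 :: rev (take i.+1 cs).
  by rewrite (take_nth None) // rev_rcons.
have := hti _ il; have tt := t2 _ il.
have -> : take (t i.+1).+1 b = take (t i).+1 b ++ take (t i.+1 - t i) (drop (t i).+1 b).
  rewrite -takeD; congr take; lia.
rewrite rev_cat => hi; apply: SlabsS hi; exact: IH (ltnW il).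
Qed.

End Fits.

(** * Greedy placement of the backbones *)

Section Place.
Variables (R : realType) (C : finType).
Implicit Types (s : memory R C).
Notation D := (option C).
Variables (n k : nat) (col : nat -> D) (yy : nat -> R) (ybot ytp : R).
Variables (b : seq D) (tt : nat -> nat).
Hypothesis n0 : (0 < n)%N.
Hypothesis sb : size b = k.+1.
Hypothesis ydecr : forall i j, (i < j < n)%N -> yy j < yy i.
Hypothesis ybounds : forall i, (i < n)%N -> ybot <= yy i <= ytp.
Hypothesis tfits : fits (~~ (yy 0 < ytp)) (mkseq col n) b tt.
Hypothesis tlast : tt n.-1 = k.
Hypothesis blast : ~~ (ybot < yy n.-1) -> nth None b k = col n.-1.

(* [k] is the index of the last backbone; [tt] is any valid assignment of slabs,
   which the greedy one never overtakes. *)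
Definition slab_of s t i := exists2 u, (u <= t)%N &
  [/\ forall j, (j < u)%N -> yy i < rmem s 3 j,
      forall j, (u <= j < t)%N -> rmem s 3 j < yy i, i = n.-1 -> u = k &
      (imem s 2 i = u /\ col i = nth None b u) \/
      [/\ (imem s 2 i).+1 = u, col i = nth None b (imem s 2 i) & col i <> nth None b u]].

Definition placing s i t :=
  [/\ [/\ imem s 4 0 = i, imem s 5 0 = k, imem s 6 0 = t & imem s 1 0 = k.+1],
      [/\ (i <= n)%N, (t <= k)%N, (i < n)%N -> (t <= tt i)%N & i = n -> t = k],
      forall j, (j <= k)%N -> cmem s 1 j = nth None b j,
      [/\ ybot <= rmem s 4 0 <= ytp, forall i', (i' < i)%N -> rmem s 4 0 <= yy i',
          i = n -> rmem s 4 0 = yy n.-1 & (i < n)%N -> (t < tt i)%N -> yy i < rmem s 4 0] &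
      [/\ forall j, (j < t)%N -> rmem s 4 0 <= rmem s 3 j <= ytp,
          forall j, (j < t)%N -> yy (minn i n.-1) < rmem s 3 j,
          forall j j', (j < j' < t)%N -> rmem s 3 j' < rmem s 3 j &
          forall i', (i' < i)%N -> slab_of s t i']].

Lemma tt_fits i : (i < n)%N -> (tt i <= k)%N /\
  ((col i == nth None b (tt i)) || (col i == nth None b (tt i).-1)).
Proof.
by move=> il; case: tfits => /(_ i); rewrite size_mkseq sb ltnS nth_mkseq // => /(_ il).
Qed.

Lemma tt_mono i : (i.+1 < n)%N -> (tt i <= tt i.+1)%N.
Proof. by case: tfits => _ /(_ i); rewrite size_mkseq. Qed.

Lemma place_init_runs s : keeps_input n col yy ybot ytp s ->
  [/\ imem s 5 0 = k, imem s 1 0 = k.+1, imem s 6 0 = 0%N &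
      forall j, (j <= k)%N -> cmem s 1 j = nth None b j] ->
  runs place_init s (max_cost place_init)
   (fun s' => keeps_input n col yy ybot ytp s' /\ placing s' 0 0).
Proof.
move=> ks [h5 h1 h6 hc]; apply: runs_keeps_input => //; apply: runs_wp.
have [_ _ _ [_ h23 _ _]] := ks.
rewrite /= h23; split=> //.
- by split=> // z; lia.
- split=> //; rewrite /update /=; last first.
  (* A first point on the top side has slab 0 in [tt], so no backbone has to fit above it. *)
  + move=> _ t0; rewrite ltNge; apply/negP => y0; case: tfits => _ _ t3.
    by rewrite t3 ?leNgt ?y0 // in t0; rewrite -leNgt.
  + by move: n0 => /[swap] <-.
  + by have /andP[ya yb] := ybounds n0; rewrite (le_trans ya yb) lexx.
- by split=> // j j'; rewrite ltn0 andbF.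
Qed.

Lemma place_body_runs s i t : keeps_input n col yy ybot ytp s -> placing s i t -> (i < n)%N ->
  runs place_body s (max_cost place_body)
   (fun s' => keeps_input n col yy ybot ytp s' /\ exists i' t',
      placing s' i' t' /\ ((n - i') + (k - t') < (n - i) + (k - t))%N).
Proof.
move=> ks pl iln; apply: runs_keeps_input => //; apply: runs_wp.
have [h00 hcol hyy [h22 h23 _ _]] := ks.
case: pl => [[h4 h5 h6 h1] [_ tk ttt _] hc [hup hupi _ hupt] [hh hhi hdec hs]].
have {}ttt := ttt iln; have {}hupt := hupt iln; have [tik tih] := tt_fits iln.
rewrite /= h4 h6 h00 h5 !hcol hyy !negb_and !negbK.
rewrite hc // hc; last by lia.
have mi : minn i n.-1 = i by lia.
rewrite mi in hhi.
case: ifP => [/andP[hit_t end_t]|].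
  (* Covers both assignments of the point, to backbone [t] and to the one above. *)
  have key a s' : (a = t /\ col i = nth None b t) \/
      [/\ a.+1 = t, col i = nth None b a & col i <> nth None b t] ->
    [/\ imem s' 4 0 = i.+1, imem s' 5 0 = k, imem s' 6 0 = t & imem s' 1 0 = k.+1] ->
    (forall i', imem s' 2 i' = if i' == i then a else imem s 2 i') ->
    rmem s' 4 0 = yy i -> (forall j, rmem s' 3 j = rmem s 3 j) ->
    (forall j, cmem s' 1 j = cmem s 1 j) -> placing s' i.+1 t.
    move=> ha h4' h2' hup' h3' hc'; split=> //.
    - split=> // [ni|ni]; first exact: leq_trans ttt (tt_mono ni).
      by case/orP: end_t => [|/eqP //]; rewrite ni ltnn.
    - by move=> j jk; rewrite hc' hc.
    - rewrite hup'; split=> //; first exact: ybounds.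
      + move=> i'; rewrite ltnS leq_eqVlt => /orP[/eqP-> //|ii].
        by apply/ltW/ydecr; rewrite ii.
      + by move=> <-.
      + by move=> ni _; apply: ydecr; rewrite ltnSn.
    - rewrite hup'; split.
      + by move=> j jt; rewrite h3' ltW ?hhi //; have /andP[] := hh _ jt.
      + move=> j jt; rewrite h3'; apply: le_lt_trans (hhi _ jt).
        have [e|e] : minn i.+1 n.-1 = i \/ (i < minn i.+1 n.-1 < n)%N by lia.
          by rewrite e.
        exact/ltW/ydecr.
      + by move=> j j' jj; rewrite !h3'; apply: hdec.
      + move=> i'; rewrite ltnS leq_eqVlt => /orP[/eqP->|ii].
          exists t => //; split; rewrite ?h2' ?eqxx //.
            by move=> j jt; rewrite h3'; apply: hhi.
            by move=> j; lia.
          by move=> ein; case/orP: end_t => [|/eqP //]; rewrite ein; lia.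
        have [u ut [u1 u2 un u3]] := hs _ ii; exists u => //.
        rewrite /slab_of h2' (ltn_eqF ii); split=> // j jj; rewrite h3'; [exact: u1|exact: u2].
  have me : ((n - i.+1) + (k - t) < (n - i) + (k - t))%N by lia.
  case: eqP hit_t => [ct _|ct /= /eqP ct']; exists i.+1, t; split=> //.
    by apply: (key t); rewrite /= /update //= ?h4 //; left.
  (* At backbone 0 the two color tests coincide, so the second cannot succeed after the first
     failed. *)
  have t0 : t != 0%N by apply/eqP => t0; rewrite t0 in ct ct'.
  apply: (key t.-1); rewrite /= /update //= ?h4 //.
  by right; rewrite prednK ?lt0n.
move=> cond.
(* The slab [tt i] passes the color test and is the last slab for the last point. Since the test
   fails at [t], the greedy slab is still strictly above [tt i]. *)
have tlt : (t < tt i)%N.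
  rewrite ltn_neqAle ttt andbT; apply: contraFN cond => /eqP tti.
  rewrite -tti in tih; rewrite tih /=; case: ltnP => //= ni.
  by rewrite tti (_ : i = n.-1) ?tlast //; lia.
move: cond => _; have {}hupt := hupt tlt.
exists i, t.+1; split; last by lia.
have /andP[up1 up2] := hup.
(* The midpoint is strictly above the point and strictly below the register, hence below all earlier
   points and backbones. *)
rewrite /= hyy; set h := (rmem s 4 0 + yy i) / 2%:R.
have h1' : yy i < h by rewrite /h; lra.
have h2' : h < rmem s 4 0 by rewrite /h; lra.
split=> //=.
- split=> //; [exact: ltnW|exact: leq_trans tlt tik|].
  by move=> ein; move: iln; rewrite ein ltnn.
- rewrite /update /= eqxx; split=> //.
  + by have /andP[? ?] := ybounds iln; apply/andP; split; lra.
  + by move=> i' ii; apply: le_trans (ltW h2') (hupi _ ii).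
  + by move=> ni; lia.
- rewrite /update /= eqxx; split.
  + move=> j; rewrite ltnS leq_eqVlt; case: eqP => [_ _|_ /= jt]; first by apply/andP; split; lra.
    by have /andP[? ?] := hh _ jt; apply/andP; split; lra.
  + move=> j; rewrite mi ltnS leq_eqVlt; case: eqP => [//|_ /= jt]; exact: hhi.
  + move=> j j' /andP[jj]; rewrite ltnS leq_eqVlt; case: eqP => [jt _|_ /= jt].
      rewrite ltn_eqF -?jt //.
      by have /andP[? _] := hh j ltac:(lia); lra.
    by rewrite ltn_eqF ?(ltn_trans jj jt) //; apply: hdec; rewrite jj.
  + move=> i' ii; have [u ut [u1 u2 un u3]] := hs _ ii; exists u; first by lia.
    split=> // j /= jj; rewrite /update /=.
      by rewrite ltn_eqF; [exact: u1|lia].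
    case: eqP => [_|jt]; last by apply: u2; lia.
    exact: lt_le_trans h2' (hupi _ ii).
Qed.

(** The backbone below a point may run at its height, namely when the last point is on the bottom
    side; such a point must not be assigned to the backbone above. *)
Definition laid_out s :=
  [/\ imem s 1 0 = k.+1, forall j, (j <= k)%N -> cmem s 1 j = nth None b j,
      forall j j', (j < j' <= k)%N -> rmem s 3 j' < rmem s 3 j,
      forall j, (j <= k)%N -> ybot <= rmem s 3 j <= ytp &
      forall i, (i < n)%N -> exists2 u, (u <= k)%N &
        [/\ forall j, (j < u)%N -> yy i < rmem s 3 j,
            forall j, (u < j <= k)%N -> rmem s 3 j < yy i, rmem s 3 u <= yy i &
            (imem s 2 i = u /\ col i = nth None b u) \/
            [/\ (imem s 2 i).+1 = u, col i = nth None b (imem s 2 i) & rmem s 3 u < yy i]]].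

Lemma place_runs s m : keeps_input n col yy ybot ytp s -> placing s 0 0 -> (n + k <= m)%N ->
  runs (Seq (While before_end place_body) place_end) s
   ((bcost before_end + max_cost place_body).+1 * m.+1 + max_cost place_end)
   (fun s' => keeps_input n col yy ybot ytp s' /\ laid_out s').
Proof.
move=> ks pl nkm.
pose I s := keeps_input n col yy ybot ytp s /\ exists i t, placing s i t.
pose mu s := ((n - imem s 4 0) + (k - imem s 6 0))%N.
apply: (runs_seq (Q1 := fun s => keeps_input n col yy ybot ytp s /\ placing s n k)).
  apply: runs_weak (runs_while (I := I) (mu := mu) (m := m) _ _ _) _ _ => //.
  - move=> s1 [ks1 [i [t pl1]]]; have [[i4 _ i6 _] _ _ _ _] := pl1.
    have [h1 _ _ _] := ks1; rewrite /before_end [beval _ _]/= i4 h1 => lin.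
    apply: runs_weak (place_body_runs ks1 pl1 lin) (leqnn _) _ => s2 [ks2 [i' [t' [pl2 lt]]]].
    split; first by split=> //; exists i', t'.
    by have [[i4' _ i6' _] _ _ _ _] := pl2; rewrite /mu i4 i6 i4' i6'.
  - by split=> //; exists 0%N, 0%N.
  - by have [[i4 _ i6 _] _ _ _ _] := pl; rewrite /mu i4 i6; lia.
  - move=> s' [[ks' [i [t pl']]]]; have [[i4 _ _ _] [ni _ _ nt] _ _ _] := pl'.
    have [h1 _ _ _] := ks'; rewrite /= i4 h1 => nin; split=> //.
    have ein : i = n by lia.
    by rewrite -ein -(nt ein).
move=> s1 [ks1 pl1]; apply: runs_keeps_input => //; apply: runs_wp.
have [_ _ _ [h22 _ _ _]] := ks1.
case: pl1 => [[h4 h5 h6 h1] _ hc [hup hupi upn _] [hh hhi hdec hs]].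
rewrite /= h6 h22 (upn erefl); set h := (yy n.-1 + ybot) / 2%:R.
have {}upn := upn erefl; rewrite upn in hup hupi hh.
have hy : h <= yy n.-1 by rewrite /h; lra.
have hyb : ybot <= h by rewrite /h; lra.
have mn : minn n n.-1 = n.-1 by lia.
rewrite mn in hhi.
split=> //; rewrite /= /update /=.
- move=> j j' /andP[jj]; rewrite leq_eqVlt; case: eqP => [jk _|_ /= jk].
    by rewrite ltn_eqF -?jk //; apply: le_lt_trans hy (hhi _ _); rewrite -jk.
  by rewrite ltn_eqF ?(ltn_trans jj jk) //; apply: hdec; rewrite jj.
- move=> j; rewrite leq_eqVlt; case: eqP => [_ _|_ /= jk]; first by apply/andP; split; lra.
  by have /andP[? ?] := hh _ jk; apply/andP; split; lra.
move=> i iln; have [u uk [u1 u2 un u3]] := hs _ iln; exists u => //.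
have hi : h <= yy i by apply: le_trans hy (hupi _ iln).
split=> /=.
- by move=> j ju; rewrite ltn_eqF; [exact: u1|lia].
- move=> j /andP[uj]; rewrite leq_eqVlt; case: eqP => [jk _|_ /= jk].
    have [e|e] : i = n.-1 \/ (i < n.-1 < n)%N by lia.
      by move: uj; rewrite un // jk ltnn.
    by apply: le_lt_trans hy (ydecr e).
  by apply: u2; rewrite ltnW.
- by case: eqP => [//|uk']; apply/ltW/u2; lia.
- case: u3 => [|[a1 a2 a3]]; [by left|right; split=> //].
  case: eqP => [uk'|uk']; last by apply: u2; lia.
  have [e|e] : i = n.-1 \/ (i < n.-1 < n)%N by lia.
    (* On the bottom side, the last point would have the color of the last backbone by [blast], and
       the lower backbone is preferred. *)
    have yl : ybot < yy n.-1.
      by rewrite -[_ < _]negbK; apply/negP => /blast; rewrite -e -uk'; congruence.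
    by rewrite e /h; lra.
  exact: le_lt_trans hy (ydecr e).
Qed.

End Place.

(** * Crossing-free labelings *)

Section Geometry.
Variables (R : realType) (C : finType) (n : nat).
Variables (B : rectangle R) (P : n.-tuple (colored_point R C)).
Hypothesis vB : valid_input B P.

Definition unobstructed (L : labeling R C n) :=
  forall i l, l <> lassign L i ->
    ~ (Num.min (py (tnth P i)) (lheight (llabel L (lassign L i)))
         <= lheight (llabel L l)
         <= Num.max (py (tnth P i)) (lheight (llabel L (lassign L i)))).

(** Vertical segments of distinct points have distinct abscissas, so every crossing involves a
    backbone. *)
Lemma crossing_freeP (L : labeling R C n) : crossing_free B P L <->
  injective (fun l => lheight (llabel L l)) /\ unobstructed L.
Proof.
have [[xlr _] inB ux _] := vB.
split=> [cf|[hinj un] l l' ll'].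
  split=> [l l' hll'|i l la hl].
    apply/eqP/negPn/negP => /eqP /cf; rewrite predeqE.
    move=> /(_ (xleft B, lheight (llabel L l))) [+ _].
    by apply; split; left; rewrite /infinite_backbone /= lexx ltW.
  have := cf _ _ la; rewrite predeqE => /(_ (px (tnth P i), lheight (llabel L l))) [+ _].
  apply; split; first by left; split=> //; have [] := inB i.
  by right; exists i.
apply/predeqP => q; split=> // -[].
case=> [[q1 q2]|[i /= il [q1 q2]]] [[q1' q2']|[j /= jl [q1' q2']]].
- by apply/ll'/hinj; rewrite -q2 -q2'.
- by apply: (un j l); rewrite jl // -q2.
- by apply: (un i l'); rewrite il; [exact: nesym|rewrite -q2'].
apply: ll'; rewrite -il -jl; congr (lassign L _); apply/eqP.
rewrite -(inj_eq val_inj) /= -(nth_uniq 0 _ _ ux) ?size_map ?size_tuple //.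
have x0 := tnth P i.
by rewrite !(nth_map x0) ?size_tuple // -!tnth_nth -q1 -q1'.
Qed.

Definition pt_color k := omap (@pcolor R C) (onth P k).
Definition pt_y k := oapp (@py R C) 0 (onth P k).

Lemma onth_tnth (i : 'I_n) : onth P i = Some (tnth P i).
Proof. by rewrite onthE (nth_map (tnth P i)) ?size_tuple // -tnth_nth. Qed.

Lemma pt_colorE (i : 'I_n) : pt_color i = Some (pcolor (tnth P i)).
Proof. by rewrite /pt_color onth_tnth. Qed.

Lemma pt_yE (i : 'I_n) : pt_y i = py (tnth P i).
Proof. by rewrite /pt_y onth_tnth. Qed.

Lemma pt_y_decr i j : (i < j < n)%N -> pt_y j < pt_y i.
Proof.
move=> /andP[ij jn]; have iln := ltn_trans ij jn.
rewrite (pt_yE (Ordinal jn)) (pt_yE (Ordinal iln)).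
have p0 := tnth P (Ordinal jn); rewrite !(tnth_nth p0) /=.
have [_ _ _ sP] := vB.
have tr : transitive (fun p q : colored_point R C => py q < py p).
  by move=> p q r h1 h2; exact: lt_trans h2 h1.
by apply: (sorted_ltn_nth tr p0 sP); rewrite ?inE ?size_tuple.
Qed.

Lemma pt_y_bounds i : (i < n)%N -> ybottom B <= pt_y i <= ytop B.
Proof. by move=> il; have [_ /(_ (Ordinal il))[_]] := vB; rewrite (pt_yE (Ordinal il)). Qed.

Lemma pt_color_some : None \notin rev (mkseq pt_color n).
Proof.
rewrite mem_rev; apply/negP => /mapP[i]; rewrite mem_iota => /andP[_ il].
by rewrite (pt_colorE (Ordinal il)).
Qed.

(** The labels are sorted by height and each point goes to its slab. Backbones below the slab of the
    last point are cut off, whence the inequality on the size. *)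
Lemma labeling_slabs (L : labeling R C n) : (0 < n)%N ->
  backbone_labeling B P L -> crossing_free B P L ->
  exists rb, [/\ slabs (~~ (pt_y 0 < ytop B)) (rev (mkseq pt_color n)) rb,
    (size rb <= nlabels L)%N &
    ~~ (ybottom B < pt_y n.-1) -> size rb = nlabels L -> nth None rb 0 = pt_color n.-1].
Proof.
move=> n0 [hyb hc] /crossing_freeP[hinj un].
pose H l := lheight (llabel L l); pose m := nlabels L.
pose ls := sort (fun l l' => H l' <= H l) (enum 'I_m).
have sls : size ls = m by rewrite size_sort size_enum_ord.
have lsin l : l \in ls by rewrite mem_sort mem_enum.
have uls : uniq ls by rewrite sort_uniq enum_uniq.
pose l0 := lassign L (Ordinal n0).
have tr : transitive (fun l l' => H l' <= H l).
  by move=> p q r h1 h2; exact: le_trans h2 h1.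
have sorted_ls : sorted (fun l l' => H l' <= H l) ls.
  by apply: sort_sorted => l l'; exact: le_total.
pose h j := H (nth l0 ls j).
have hdec j j' : (j < j' < m)%N -> h j' < h j.
  move=> /andP[jj jm]; have jm' := ltn_trans jj jm.
  rewrite lt_neqAle (sorted_ltn_nth tr l0 sorted_ls) ?inE ?sls // andbT.
  apply/eqP => /hinj /eqP; rewrite nth_uniq ?sls // => /eqP e.
  by rewrite e ltnn in jj.
pose b := map (fun l => Some (lcolor (llabel L l))) ls.
pose idx i := if insub i is Some o then index (lassign L o) ls else 0%N.
have idxP i : (i < n)%N -> (idx i < m)%N /\ nth None b (idx i) = pt_color i.
  move=> il; rewrite /idx insubT /=; have li := lsin (lassign L (Sub i il)).
  rewrite -[X in (_ < X)%N]sls index_mem; split=> //.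
  rewrite (nth_map l0) ?index_mem // nth_index // hc.
  exact/esym/(pt_colorE (Ordinal il)).
have unob i j : (i < n)%N -> (j < m)%N -> j != idx i ->
    ~ (Num.min (pt_y i) (h (idx i)) <= h j <= Num.max (pt_y i) (h (idx i))).
  move=> il jm; rewrite /idx insubT => ji.
  rewrite /h nth_index // (pt_yE (Ordinal il)); apply: un.
  move/eqP; apply/negP; apply: contra ji => /eqP <-.
  by rewrite index_uniq ?sls.
(* The number of backbones at or above the point. *)
pose u i := find (fun j => h j < pt_y i) (iota 0 m).
have um i : (u i <= m)%N by rewrite -[X in (_ <= X)%N](size_iota 0 m) find_size.
have ubelow i j : (j < u i)%N -> pt_y i <= h j.
  move=> ju; have := before_find 0%N ju; rewrite nth_iota ?add0n ?leNgt; last first.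
    exact: leq_trans ju (um i).
  by move=> ->.
have uabove i : (u i < m)%N -> h (u i) < pt_y i.
  move=> uim; have := @nth_find _ 0%N (fun j => h j < pt_y i) (iota 0 m).
  by rewrite has_find size_iota -/(u i) nth_iota // add0n; exact.
have idxu i : (i < n)%N -> (idx i = u i \/ (idx i).+1 = u i).
  move=> il; have [im _] := idxP i il.
  have [iu|ui|->] := ltngtP (idx i) (u i); last by left.
    right; apply/eqP; rewrite eqn_leq iu leqNgt; apply/negP => iu2.
    have um' := um i.
    apply: (unob i (u i).-1 il); [lia|lia|].
    have h1 := ubelow i (u i).-1 ltac:(lia).
    have h2 := hdec (idx i) (u i).-1 ltac:(lia).
    by rewrite ge_min h1 le_max (ltW h2) !orbT.
  exfalso; apply: (unob i (u i) il); [lia|lia|].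
  have h1 := uabove i ltac:(lia).
  have h2 := hdec (u i) (idx i) ltac:(lia).
  by rewrite ge_min (ltW h2) le_max (ltW h1) !orbT.
have umono i j : (i < j < n)%N -> (u i <= u j)%N.
  move=> ij; rewrite leqNgt; apply/negP => uji.
  have := ubelow _ _ uji; rewrite leNgt => /negP; apply.
  apply: lt_trans (pt_y_decr ij); apply: uabove.
  exact: leq_trans uji (um i).
have m0 : (0 < m)%N by have [] := idxP 0%N n0; lia.
set T := ~~ (_ < _).
(* The minimum treats points with no backbone below them: their label is the last backbone, and they
   join the slab just above it. A first point on the top side goes to slab 0 even if a backbone runs
   along that side. *)
pose t i := if T && (i == 0%N) then 0%N else minn (u i) m.-1.
have sb : size b = m by rewrite size_map.
have ft : fits T (mkseq pt_color n) b t.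
  split.
  - move=> i; rewrite size_mkseq sb => il; rewrite nth_mkseq //; have [im ic] := idxP i il.
    rewrite /t; case: ifP => [/andP[Ht /eqP i0]|_].
      split=> //; rewrite -ic; suff -> : idx i = 0%N by rewrite eqxx.
      apply/eqP/negPn/negP => i1; apply: (unob i 0%N il m0); first by rewrite eq_sym.
      have hb : h 0%N <= ytop B by have /andP[] := hyb (nth l0 ls 0).
      have h2 := hdec 0%N (idx i) ltac:(lia).
      rewrite /T -leNgt in Ht; rewrite ge_min (ltW h2) le_max i0 (le_trans hb Ht) orbT //.
    split; first by lia.
    rewrite -ic; have [e|e] := idxu i il; have um' := um i.
      by rewrite e (_ : minn _ _ = u i) ?eqxx //; lia.
    have [e2|e2] : minn (u i) m.-1 = idx i \/ (minn (u i) m.-1).-1 = idx i by lia.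
      by rewrite e2 eqxx.
    by rewrite e2 eqxx orbT.
  - move=> i; rewrite size_mkseq /t => il; case: ifP => // _.
    rewrite andbF; have := umono i i.+1 ltac:(lia); lia.
  - by rewrite /t => ->.
have := fits_slabs _ ft; rewrite size_mkseq => /(_ n0) Hs.
have tm : (t n.-1 < m)%N by rewrite /t; case: ifP => // _; lia.
eexists; split; first exact: Hs.
  by rewrite size_rev size_takel // sb.
rewrite size_rev size_takel ?sb // => Hb e.
rewrite nth_rev ?size_takel ?sb // subn1 /= nth_take //.
have nl : (n.-1 < n)%N by lia.
have [im <-] := idxP _ nl; congr nth.
(* Otherwise the last backbone, which is not below the bottom side, would meet the leader of the
   last point. *)
rewrite -[t _]/((t n.-1).+1.-1) e -/m; apply/eqP/negPn/negP => ne.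
apply: (unob n.-1 m.-1 nl); [lia|exact: ne|].
have h2 := hdec (idx n.-1) m.-1 ltac:(lia).
have hb : ybottom B <= h m.-1 by have /andP[] := hyb (nth l0 ls m.-1).
rewrite -leNgt in Hb.
by rewrite ge_min (le_trans Hb hb) le_max (ltW h2) orbT.
Qed.

End Geometry.

(** * Reading off the labeling and assembling the passes *)

Lemma laid_out_labeling (R : realType) (C : finType) (n : nat) (B : rectangle R)
    (P : n.-tuple (colored_point R C)) s k b : (0 < n)%N -> valid_input B P ->
  keeps_input n (pt_color P) (pt_y P) (ybottom B) (ytop B) s ->
  size b = k.+1 -> None \notin b ->
  laid_out n k (pt_color P) (pt_y P) (ybottom B) (ytop B) b s ->
  exists L : labeling R C n, [/\ nlabels L = k.+1, output_memory s L,
    backbone_labeling B P L & crossing_free B P L].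
Proof.
move=> n0 vB [_ _ _ [_ _ h3 _]] sb bN [h1 hc hdec hbd hslab].
pose c0 := pcolor (tnth P (Ordinal n0)).
have bE j : (j <= k)%N -> nth None b j = Some (odflt c0 (nth None b j)).
  move=> jk; have := mem_nth None (_ : (j < size b)%N); rewrite sb ltnS jk => /(_ isT).
  by case: (nth None b j) => // Hb; rewrite Hb in bN.
have ak (i : 'I_n) : (imem s 2 i <= k)%N.
  have [u uk [_ _ _ [[au _]|[au _ _]]]] := hslab _ (ltn_ord i); first by rewrite au.
  by rewrite ltnW // au.
pose L := @Labeling R C n k.+1 (fun l => Label false (rmem s 3 l) (odflt c0 (nth None b l)))
  (fun i => inord (imem s 2 i)).
have aE (i : 'I_n) : lassign L i = imem s 2 i :> nat by rewrite /= inordK // ltnS.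
exists L; split=> //.
- split=> // l.
  have lk : (l <= k)%N by rewrite -ltnS.
  by split; rewrite ?h3 // hc // bE.
- split=> [l|i]; first by apply: hbd; rewrite -ltnS.
  apply: Some_inj; rewrite [lcolor _]/= -bE ?aE // -pt_colorE.
  by have [u uk [_ _ _ [[<- ->]|[_ -> _]]]] := hslab _ (ltn_ord i).
apply/(crossing_freeP vB); split=> [l l' /= hl|i l la /andP[]].
  apply/val_inj/eqP; rewrite eqn_leq; apply/andP; split; rewrite leqNgt; apply/negP => ll.
    by have := hdec l' l; rewrite ll -ltnS ltn_ord hl ltxx => /(_ isT).
  by have := hdec l l'; rewrite ll -ltnS ltn_ord hl ltxx => /(_ isT).
have {}la : nat_of_ord l != imem s 2 i.
  by apply: contra_notN la => /eqP e; apply: val_inj; rewrite /= e inordK // ltnS.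
have lk : (l <= k)%N by rewrite -ltnS.
rewrite [lheight _]/= [X in Num.max _ X]/= inordK ?ltnS // -pt_yE ge_min le_max.
have [u uk [u1 u2 u3 u4]] := hslab _ (ltn_ord i).
have [la1 la2] : ((l < imem s 2 i)%N -> pt_y P i < rmem s 3 l) /\
    ((imem s 2 i < l)%N -> rmem s 3 l < pt_y P i).
  case: u4 => [[-> _]|[au _ u4]]; split=> [lu|ul].
  - exact: u1.
  - by apply: u2; rewrite ul.
  - by apply: u1; rewrite -au ltnW.
  - have [<- //|ul2] := eqVneq u l; apply: u2; rewrite lk andbT ltn_neqAle ul2 /=.
    by rewrite -au.
have [lu|ul|e] := ltngtP l (imem s 2 i); last by rewrite e eqxx in la.
  have hy := la1 lu; have hl := hdec l (imem s 2 i); rewrite lu ak in hl.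
  by move=> _ /=; rewrite !leNgt hy hl.
have hy := la2 ul; have hl := hdec (imem s 2 i) l; rewrite ul lk in hl.
by rewrite /= !leNgt hy hl.
Qed.

Lemma rev_mkseq_cons (T : Type) (f : nat -> T) n : (0 < n)%N ->
  exists2 l, rev (mkseq f n) = f n.-1 :: l & (size l).+1 = n.
Proof.
case: n => // n _; exists (rev (mkseq f n)); first by rewrite mkseqS rev_rcons.
by rewrite size_rev size_mkseq.
Qed.

Lemma size_finish_gt0 (C : eqType) Bt (st : scan_state C) z : (0 < size (finish Bt st z))%N.
Proof.
by case: st => x y g1 g2 e tb /=; case: ifP => _; case: Bt; rewrite /= ?size_back.
Qed.

Definition label_cost : nat :=
  (bcost (BLtI (IConst 0) (ivar 0)) + max_cost init_code +
   (bcost before_end + max_cost scan_body).+1 + max_cost finish_code +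
   (bcost color_test + max_cost color_body).+1 + max_cost place_init +
   (bcost before_end + max_cost place_body).+1 + max_cost place_end).+2.

Lemma label_code_runs (R : realType) (C : finType) (n : nat) (B : rectangle R)
    (P : n.-tuple (colored_point R C)) (T := ~~ (pt_y P 0 < ytop B))
    (rb := finish (~~ (ybottom B < pt_y P n.-1))
             (scan T (rev (mkseq (pt_color P) n))) (pt_color P n.-1)) :
  (0 < n)%N -> valid_input B P ->
  runs label_code (input_memory B P) (label_cost * (2 * n).+2)
    (fun s => exists L : labeling R C n, [/\ nlabels L = size rb, output_memory s L,
       backbone_labeling B P L & crossing_free B P L]).
Proof.
move=> n0 vB.
have ks : keeps_input n (pt_color P) (pt_y P) (ybottom B) (ytop B) (input_memory B P).
  split=> //; split=> // k /=; by case: k.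
have [l el sl] := rev_mkseq_cons (pt_color P) n0.
have lN := pt_color_some P; rewrite el in lN.
have [Hs Hb rbN rbs] := finish_slabs T (~~ (ybottom B < pt_y P n.-1)) lN.
rewrite -el -/rb in Hs Hb rbN rbs.
pose k := (size rb).-1.
have srb : size rb = k.+1 by rewrite prednK // size_finish_gt0.
(* One backbone per phase and possibly one at the bottom make at most n + 1, so the placing loop
   takes at most 2n rounds. *)
have kn : (k <= n)%N by rewrite -ltnS -srb -sl.
rewrite -el in Hs lN; have [t [ft tl]] := slabs_fits Hs lN.
rewrite revK srb size_rev size_mkseq /= in ft tl.
have brev : size (rev rb) = k.+1 by rewrite size_rev.
have blast : ~~ (ybottom B < pt_y P n.-1) -> nth None (rev rb) k = pt_color P n.-1.
  by move=> /Hb <-; rewrite nth_rev srb // subnn.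
have H : runs (Seq init_code (Seq (While before_end scan_body) (Seq finish_code
    (Seq (While color_test color_body) (Seq place_init
      (Seq (While before_end place_body) place_end)))))) (input_memory B P)
    (max_cost init_code + ((bcost before_end + max_cost scan_body).+1 * n.+1 +
    (max_cost finish_code + ((bcost color_test + max_cost color_body).+1 * n.+1 +
    (max_cost place_init + ((bcost before_end + max_cost place_body).+1 * (n + k).+1 +
     max_cost place_end))))))%N
    (fun s => keeps_input n (pt_color P) (pt_y P) (ybottom B) (ytop B) s /\
      laid_out n k (pt_color P) (pt_y P) (ybottom B) (ytop B) (rev rb) s).
  apply: runs_seq (init_runs ks _ _) _ => // [a j ha|s1 [ks1 hs1]].
    by rewrite /= ifN //; lia.
  apply: runs_seq (scan_runs n0 ks1 hs1) _ => s2 [ks2 hs2].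
  apply: runs_seq (finish_runs ks2 hs2) _ => s3 [ks3 [r [tb [hp]]]].
  rewrite -/T -/rb => eb.
  have stb : size tb = k by apply/eq_add_S; rewrite -srb -eb size_back.
  apply: (runs_seq (color_runs (m := n) ks3 hp _)) => [|s4 [ks4]]; first by rewrite stb.
  rewrite eb stb => hc4.
  have pb := pt_y_bounds vB; have pd := @pt_y_decr _ _ _ _ _ vB.
  apply: runs_seq (place_init_runs n0 brev pb ft tl blast ks4 hc4) _ => s5 [ks5 pl].
  exact: (place_runs n0 brev pd pb ft tl blast ks5 pl (leqnn _)).
have [t1 [s [e1 h1 [ks1 lo]]]] := H.
exists (bcost (BLtI (IConst 0) (ivar 0)) + t1).+1, s; split; first exact: ExecIfTrue.
  apply: (leq_trans (n := (bcost (BLtI (IConst 0) (ivar 0)) + _).+1)).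
    by rewrite ltnS leq_add2l; exact: h1.
  have nk : ((n + k).+1 <= (2 * n).+2)%N by lia.
  have nn : (n.+1 <= (2 * n).+2)%N by lia.
  rewrite /label_cost; move: (bcost (BLtI _ _)) (max_cost init_code)
    (_ + max_cost scan_body).+1%N (max_cost finish_code)
    (_ + max_cost color_body).+1%N (max_cost place_init)
    (_ + max_cost place_body).+1%N (max_cost place_end) => c1 c2 c3 c4 c5 c6 c7 c8.
  have N0 : (0 < (2 * n).+2)%N by [].
  move: nk nn N0; move: (n + k).+1%N n.+1 (2 * n).+2%N => N1 N2 N nk nn N0.
  have := leq_mul (leqnn c7) nk; have := leq_mul (leqnn c3) nn; have := leq_mul (leqnn c5) nn.
  have lN0 c : (c <= c * N)%N by rewrite leq_pmulr.
  have := lN0 c1; have := lN0 c2; have := lN0 c4; have := lN0 c6; have := lN0 c8.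
  by rewrite !mulSn !mulnDl; lia.
rewrite srb; have := laid_out_labeling n0 vB ks1 brev _ lo.
by apply; rewrite mem_rev.
Qed.

Theorem theorem1 (R : realType) :
  exists (prog : cmd) (T : nat -> nat),
    ((fun n : nat => (T n)%:R : R) =O_\oo (fun n : nat => n%:R : R)) /\
    forall (C : finType) (n : nat) (B : rectangle R)
           (P : n.-tuple (colored_point R C)),
      valid_input B P ->
      exists (t : nat) (s : memory R C) (L : labeling R C n),
        [/\ exec prog (input_memory B P) t s,
            (t <= T n)%N,
            output_memory s L &
            minimum_labeling B P L].
Proof.
exists label_code, (fun n => label_cost * (2 * n).+2)%N; split.
  (* The factor 4 comes from 2n + 2 being at most 4n for positive n. *)
  apply/eqO_exP; exists (label_cost * 4)%:R; first by rewrite ltr0n.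
  exists 1%N => // n /= n1; rewrite !ger0_norm ?ler0n // -natrM ler_nat.
  by rewrite -mulnA leq_mul2l; apply/orP; right; lia.
move=> C n B P vB; case: (posnP n) => [n0|n0].
  subst n.
  pose L := @Labeling R C 0 0 (fun l => match l with Ordinal _ h => ltac:(by []) end) id.
  exists (bcost (BLtI (IConst 0) (ivar 0)) + 1).+1, (input_memory B P), L.
  split=> //; first by apply: ExecIfFalse => //; exact: ExecSkip.
  - by split=> // -[].
  - by split=> //; [split=> -[]|move=> []].
have [t [s [et ht [L [nL oL bL cL]]]]] := label_code_runs n0 vB.
exists t, s, L; split=> //; split=> // L' bL' cL'.
have [rb [Hs rbs Hb]] := labeling_slabs vB n0 bL' cL'.
have lN := pt_color_some P.
have [l el _] := rev_mkseq_cons (pt_color P) n0.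
rewrite nL el; rewrite el in Hs lN.
exact: finish_min Hs lN rbs Hb.
Qed.
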